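(* $\operatorname{Ker}(Z^\diamondsuit)=\mathsf{Drop1}$, where $\mathsf{Drop1}=\operatorname{span}_{\mathbb{Q}}\{w-\mathcal{D}(w)\mid w\in y\mathcal{H}x\}$.
   Context: $[n]=\{1,\dots,n\}$. An index is a tuple of positive integers; admissible = nonempty with last entry $\ge2$. For $N\ge1$ and admissible $\boldsymbol{k}=(k_1,\dots,k_r)$: $[r]^1_{\boldsymbol{k}}=\{i:k_i=1\}$, $S_{r,N}(A)=\{(n_1,\dots,n_r)\in[N-1]^r: n_i\le n_{i+1}\ (i\in A),\ n_i<n_{i+1}\ (i\in[r-1]\setminus A)\}$, $\zeta^\diamondsuit_N(\boldsymbol{k})=\sum_{A\subset[r]^1_{\boldsymbol{k}}}\sum_{S_{r,N}(A)}\prod_{i\in A}(N-n_i)^{-1}\prod_{i\notin A}n_i^{-k_i}$, $\zeta^\diamondsuit(\boldsymbol{k})=(\zeta^\diamondsuit_N(\boldsymbol{k}))_{N\ge1}\in\mathbb{Q}^{\mathbb{N}}$. $\mathcal{H}=\mathbb{Q}\langle x,y\rangle$, $\mathcal{H}^0=\mathbb{Q}+y\mathcal{H}x$, $\mathcal{H}^{\ge2}=\mathbb{Q}+yx\,\mathbb{Q}\langle x,yx\rangle$, $e_k=yx^{k-1}$; $Z^\diamondsuit\colon\mathcal{H}^0\to\mathbb{Q}^{\mathbb{N}}$ is $\mathbb{Q}$-linear with $Z^\diamondsuit(1)=(1)_N$, $Z^\diamondsuit(e_{k_1}\cdots e_{k_r})=\zeta^\diamondsuit(k_1,\dots,k_r)$.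 For an index $\boldsymbol{c}=(c_1,\dots,c_r)$: $[r]^1_{\boldsymbol{c}}=\{i:c_i=1\}$, $[r]^{>1}_{\boldsymbol{c}}=\{i:c_i>1\}$; for $A\subset[r]$ with $[r]\setminus A=\{i_1<\dots<i_t\}$, $\boldsymbol{c}_{(-A)}=(c_{i_1},\dots,c_{i_t})$, $\boldsymbol{c}_{(-A)}-\boldsymbol{\delta}_B=(c_{i_1}-\delta_{i_1\in B},\dots,c_{i_t}-\delta_{i_t\in B})$. $A\subset[2s]$ is even-odd if (even $i\in A\Rightarrow i+1\in A$) and (odd $i\in A\Rightarrow i-1\in A$); odd-even if (odd $i\in A\Rightarrow i+1\in A$) and (even $i\in A\Rightarrow i-1\in A$). $\mathcal{D}\colon\mathcal{H}^0\to\mathcal{H}^{\ge2}$ is $\mathbb{Q}$-linear with $\mathcal{D}(1)=1$ and, with $\mathfrak{D}(\boldsymbol{c})=\mathcal{D}(y^{c_1}x^{c_2}\cdots y^{c_{2s-1}}x^{c_{2s}})$ for even-depth $\boldsymbol{c}$ and $\mathfrak{D}(\varnothing)=1$, \begin{align*} \mathfrak{D}(\boldsymbol{c})&=\sum_{\substack{A\subset[2s]^1_{\boldsymbol{c}}\\ A\text{ even-odd}}}\ \sum_{\substack{B\subset[2s]^{>1}_{\boldsymbol{c}},\ \#A+\#B\ge1\\ \{2r,2r+1\}\not\subset B\ (r\in[s-1])}}(-1)^{\#B-1}\mathfrak{D}(\boldsymbol{c}_{(-A)}-\boldsymbol{\delta}_B)\,x^{\#A+\#B}\\ &\quad+\sum_{\substack{A\subset[2s]^1_{\boldsymbol{c}}\\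 A\text{ even-odd}}}\ \sum_{\substack{B\subset[2s]^{>1}_{\boldsymbol{c}},\ \#A+\#B\ge2\\ \{2r,2r+1\}\not\subset B\ (r\in[s-1])}}(-1)^{\#B-1}\mathfrak{D}(\boldsymbol{c}_{(-A)}-\boldsymbol{\delta}_B)\,yx^{\#A+\#B-1}\\ &\quad+\sum_{\substack{A\subset[2s]^1_{\boldsymbol{c}}\\ A\text{ odd-even}}}\ \sum_{\substack{B\subset[2s]^{>1}_{\boldsymbol{c}},\ \#A+\#B\ge2\\ \{2r-1,2r\}\not\subset B\ (r\in[s])}}(-1)^{\#B}\mathfrak{D}(\boldsymbol{c}_{(-A)}-\boldsymbol{\delta}_B)\,yx^{\#A+\#B-1}. \end{align*} *)

(* Defs.v *)
(* the free algebra Q<x,y> is the monoid algebra of the free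
   monoid on {x,y} (multinomials' monalg: {malg rat[{fmonom bool}]}).
   Letters: false = x, true = y. *)
From HB Require Import structures.
From mathcomp Require Import all_boot all_order all_algebra.
From mathcomp Require Import finmap.
From mathcomp.multinomials Require Import monalg.

Set Implicit Arguments.
Unset Strict Implicit.
Unset Printing Implicit Defensive.

Import Order.TTheory GRing.Theory Num.Theory.
Local Open Scope ring_scope.

Definition H := {malg rat[{fmonom bool}]}.

Definition letter (b : bool) : H := mkmalgU (fmu b) 1.
Definition xH : H := letter false.
Definition yH : H := letter true.

Definition wordH (w : seq bool) : H := \prod_(b <- w) letter b.

Definition in_yHx (p : H) : Prop := exists h : H, p = yH * h * xH.
Definition in_H0 (p : H) : Prop := exists (c : rat) (h : H), p = c%:MP + yH * h * xH.

(* k is given as a list (k_1,...,k_r); 0-based indices i : 'I_r stand for i+1 *)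
Definition zetad (k : seq nat) (N : nat) : rat :=
  \sum_(A : {set 'I_(size k)} | A \subset [set i : 'I_(size k) | nth 0%N k i == 1%N])
   \sum_(n : {ffun 'I_(size k) -> 'I_N} |
          [forall i, 0 < n i]%N &&
          [forall i : 'I_(size k), forall j : 'I_(size k),
             (val j == (val i).+1) ==>
             (if i \in A then (n i <= n j)%N else (n i < n j)%N)])
     ((\prod_(i in A) (((N - n i)%N)%:R)^-1) *
      (\prod_(i in ~: A) (((n i)%:R) ^- (nth 0%N k i)))).

(* The index (k_1,...,k_r) of a word e_{k_1}...e_{k_r} = y x^{k_1-1} ... y x^{k_r-1}:
   idx_aux s is the index for the word y :: s. *)
Fixpoint idx_aux (s : seq bool) : seq nat :=
  match s with
  | [::] => [:: 1%N]
  | false :: s' => match idx_aux s' with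
                   | k :: ks => k.+1 :: ks
                   | [::] => [:: 1%N]
                   end
  | true :: s' => 1%N :: idx_aux s'
  end.

(* value of Z^diamond on a word of H^0 (junk 0 on words outside H^0) *)
Definition zeta_word (w : seq bool) (N : nat) : rat :=
  match w with
  | [::] => 1
  | true :: s => zetad (idx_aux s) N
  | false :: _ => 0
  end.

(* Z^diamond : H^0 -> Q^N, the Q-linear extension (sequences indexed by N >= 1) *)
Definition Zd (p : H) (N : nat) : rat :=
  \sum_(m <- msupp p) mcoeff m p * zeta_word (fmonom_val m) N.

Fixpoint runs (w : seq bool) : seq (bool * nat) :=
  match w with
  | [::] => [::]
  | a :: w' => match runs w' with
               | (b, n) :: t => if a == b then (b, n.+1) :: t else (a, 1%N) :: (b, n) :: t
               | [::] => [:: (a, 1%N)]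
               end
  end.
Definition exps (w : seq bool) : seq nat := map snd (runs w).

Section DSets.
Variable m : nat.
Definition pos (i : 'I_m) : nat := (val i).+1.
Definition memb (A : {set 'I_m}) (k : nat) : bool :=
  [exists j : 'I_m, (pos j == k) && (j \in A)].
Definition even_odd (A : {set 'I_m}) : bool :=
  [forall i in A, if odd (pos i) then memb A (pos i).-1 else memb A (pos i).+1].
Definition odd_even (A : {set 'I_m}) : bool :=
  [forall i in A, if odd (pos i) then memb A (pos i).+1 else memb A (pos i).-1].
(* {2r,2r+1} not subset of B for r in [s-1]  (2r+1 <= 2s automatically) *)
Definition noEO (B : {set 'I_m}) : bool :=
  [forall i in B, ~~ odd (pos i) ==> ~~ memb B (pos i).+1].
Definition noOE (B : {set 'I_m}) : bool :=
  [forall i in B, odd (pos i) ==> ~~ memb B (pos i).+1].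
End DSets.

Definition cdrop (c : seq nat) (A B : {set 'I_(size c)}) : seq nat :=
  [seq (nth 0%N c i - (i \in B))%N | i : 'I_(size c) <- enum 'I_(size c) & i \notin A].

(* frak D with fuel; the intended value is Dfrak_fuel (sumn c) c. Each recursive
   argument has weight <= sumn c - 1, so the fuel never runs out on valid input. *)
Fixpoint Dfrak_fuel (fuel : nat) (c : seq nat) : H :=
  match fuel with
  | 0%N => 1
  | fuel'.+1 =>
    if c is [::] then 1 else
    let ones := [set i : 'I_(size c) | nth 0%N c i == 1%N] in
    let bigs := [set i : 'I_(size c) | (1 < nth 0%N c i)%N] in
    (\sum_(A : {set 'I_(size c)} | (A \subset ones) && even_odd A)
      \sum_(B : {set 'I_(size c)} | [&& B \subset bigs, (1 <= #|A| + #|B|)%N & noEO B])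
        (-1) ^+ (#|B|.+1) *: (Dfrak_fuel fuel' (cdrop A B) * xH ^+ (#|A| + #|B|)))
    + (\sum_(A : {set 'I_(size c)} | (A \subset ones) && even_odd A)
      \sum_(B : {set 'I_(size c)} | [&& B \subset bigs, (2 <= #|A| + #|B|)%N & noEO B])
        (-1) ^+ (#|B|.+1) *: (Dfrak_fuel fuel' (cdrop A B) * (yH * xH ^+ (#|A| + #|B|).-1)))
    + (\sum_(A : {set 'I_(size c)} | (A \subset ones) && odd_even A)
      \sum_(B : {set 'I_(size c)} | [&& B \subset bigs, (2 <= #|A| + #|B|)%N & noOE B])
        (-1) ^+ #|B| *: (Dfrak_fuel fuel' (cdrop A B) * (yH * xH ^+ (#|A| + #|B|).-1)))
  end.

Definition Dfrak (c : seq nat) : H := Dfrak_fuel (sumn c) c.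

Definition D_word (w : seq bool) : H := if w is [::] then 1 else Dfrak (exps w).
Definition Dmap (p : H) : H := \sum_(m <- msupp p) mcoeff m p *: D_word (fmonom_val m).

Definition in_KerZd (p : H) : Prop := in_H0 p /\ forall N : nat, (0 < N)%N -> Zd p N = 0.

Definition in_Drop1 (p : H) : Prop :=
  exists s : seq (rat * H),
    (forall q, q \in s -> in_yHx q.2) /\
    p = \sum_(q <- s) q.1 *: (q.2 - Dmap q.2).

(* Main.v *)
Require Import Defs.
From mathcomp Require Import all_boot all_order all_algebra.
From mathcomp Require Import finmap.
From mathcomp.multinomials Require Import monalg.
From mathcomp Require Import ring lra zify.

(** D preserves Z^diamond, and it maps into the span of the words e_k1 ... e_kr
    with all ki >= 2, whose truncated sums are linearly independent over Q. Hence,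
    if p = c + q with q in y H x lies in the kernel, then c + D q, which has the same
    image as p, vanishes, so that p = q - D q.

    Differencing the recursion for D in N, the invariance of Z^diamond under D becomes
      sum_(A even-odd, B) (-1)^#B N^-(#A+#B) Z_(N+1)(c_(-A) - delta_B)
      = sum_(A odd-even, B) (-1)^#B N^-(#A+#B) Z_N(c_(-A) - delta_B).
    It is proved for the sums restricted to n_1 > a: in generating series over the
    block exponents both sides (chi and rho below) satisfy the same recursion in a.

    Linear independence is q-adic: for N = m q + a, the most singular part of a
    truncated sum at a large prime q is the same sum truncated at m + 1. *)

(** For a word whose exponents are all at least 2, passing from N to N + 1 only adds the terms whose
    largest variable is N. Appending x^n multiplies this difference by N^-n, and appending y x^(n-1)
    with n >= 2 turns it into N^-n times the value at N; this is how the recursion for D becomes an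
    identity at each N. The word to which D is applied may have entries 1, and for these N also
    occurs inside the summands 1 / (N - n_i), so its largest variable cannot be split off. The
    smallest one can, which is why the identity is proved for all lower bounds a, downwards from a =
    N - 1. In generating series it rests on one cancellation: with u = N - (a + 1) and v = a + 1 one
    has u + v = N, so the factor 1 - (X + Y)/N for keeping a pair or decrementing one of its entries
    equals ((u - Y) + (v - X))/N and splits the product of the poles (u - Y)^-1 (v - X)^-1 into
    their sum. *)

Set Implicit Arguments.
Unset Strict Implicit.
Unset Printing Implicit Defensive.
Import Order.TTheory GRing.Theory Num.Theory.
Local Open Scope ring_scope.

(* The part n_1 > a of the sum defining zeta^diamond_N. An index i in A allows
   n_i = n_(i+1), so the remaining sum restarts above n - 1. *)
Fixpoint zeta_tail (N a : nat) (k : seq nat) : rat :=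
  if k is k1 :: k' then
    \sum_(a.+1 <= n < N) (n%:R ^- k1 * zeta_tail N n k'
       + (k1 == 1%N)%:R * ((N - n)%N%:R^-1 * zeta_tail N n.-1 k'))
  else 1.

(* The word y^c_1 x^c_2 ... y^c_(2s-1) x^c_(2s) is encoded by the list b of the
   c_i - 1, so that c_i = 1 becomes b_i = 0 and no positivity has to be assumed. *)
Fixpoint block_index (b : seq nat) : seq nat :=
  if b is i :: b' then
    if b' is j :: d then nseq i 1%N ++ j.+2 :: block_index d else [::]
  else [::].

Definition block_tail (N a : nat) (b : seq nat) : rat := zeta_tail N a (block_index b).

(* Multiplication by the variable Y on coefficient sequences of power series in Y. *)
Definition shift (g : nat -> rat) (i : nat) : rat := if i is i'.+1 then g i' else 0.

Lemma eq_shift g1 g2 i : g1 =1 g2 -> shift g1 i = shift g2 i.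
Proof. by case: i => //= i ->. Qed.

Lemma zeta_tail_rec N a k1 k : (a.+1 < N)%N ->
  zeta_tail N a (k1 :: k) = zeta_tail N a.+1 (k1 :: k) + a.+1%:R ^- k1 * zeta_tail N a.+1 k
    + (k1 == 1%N)%:R * ((N - a.+1)%N%:R^-1 * zeta_tail N a k).
Proof. by move=> aN; rewrite [LHS]big_ltn //= addrC addrA. Qed.

Lemma zeta_tail0 N a k1 k : (N <= a.+1)%N -> zeta_tail N a (k1 :: k) = 0.
Proof. by move=> Na; rewrite /= big_geq. Qed.

Lemma block_tail_recS N a i j d : (a.+1 < N)%N ->
  block_tail N a [:: i.+1, j & d] = block_tail N a.+1 [:: i.+1, j & d]
    + a.+1%:R^-1 * block_tail N a.+1 [:: i, j & d]
    + (N - a.+1)%N%:R^-1 * block_tail N a [:: i, j & d].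
Proof. by move=> aN; rewrite /block_tail /= -!/(zeta_tail _ _ (_ :: _)) zeta_tail_rec //= mul1r expr1. Qed.

Lemma block_tail_rec0 N a j d : (a.+1 < N)%N ->
  block_tail N a [:: 0%N, j & d] = block_tail N a.+1 [:: 0%N, j & d]
    + a.+1%:R ^- j.+2 * block_tail N a.+1 d.
Proof. by move=> aN; rewrite /block_tail /= -!/(zeta_tail _ _ (_ :: _)) zeta_tail_rec //= mul0r addr0. Qed.

Lemma block_tail0 N a i j d : (N <= a.+1)%N -> block_tail N a [:: i, j & d] = 0.
Proof. by move=> Na; rewrite /block_tail; case: i => [|i]; exact: zeta_tail0. Qed.

(** * Signed sums over the pairs (A, B), as operators on functions of lists *)

Section Ops.
Variable t : rat.

(* With t = 1/N this is the signed sum over the pairs (A, B) of the odd-even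
   kind: each pair of adjacent entries is kept, has one entry decremented, or is
   dropped when both are 1. Lists of odd length, with a single last entry, occur
   in the even-odd sum [reduce_tail], whose pairing is shifted by one. *)
Fixpoint reduce (f : seq nat -> rat) (b : seq nat) : rat :=
  if b is i :: b' then
    if b' is j :: d then
      reduce (fun s => f [:: i, j & s]) d
      - t * shift (fun i' => reduce (fun s => f [:: i', j & s]) d) i
      - t * shift (fun j' => reduce (fun s => f [:: i, j' & s]) d) j
      + t ^+ 2 * ((i == 0%N) && (j == 0%N))%:R * reduce f d
    else f [:: i] - t * shift (fun i' => f [:: i']) i
  else f [::].

(** An even-odd A contains neither 1 nor 2s, whose partners lie outside [2s]. The first entry is
    therefore only kept or decremented, and the pairing restarts after it. *)
Definition reduce_tail (f : seq nat -> rat) (b : seq nat) : rat :=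
  if b is i :: b' then
    reduce (fun s => f (i :: s) - t * shift (fun i' => f (i' :: s)) i) b'
  else f [::].

Lemma list2_ind (T : Type) (P : seq T -> Prop) :
  P [::] -> (forall x, P [:: x]) -> (forall x y s, P s -> P [:: x, y & s]) ->
  forall s, P s.
Proof.
move=> P0 P1 P2 s; suff: P s /\ forall x, P (x :: s) by case.
by elim: s => [|y s [IH1 IH2]]; split=> // x; apply: P2.
Qed.

Lemma reduceD x f g b :
  reduce (fun s => x * f s + g s) b = x * reduce f b + reduce g b.
Proof.
elim/list2_ind: b f g => [//|j|i j d IH] f g /=; first by case: j => [|j] /=; ring.
by rewrite !IH; case: i => [|i]; case: j => [|j] /=; rewrite ?IH; ring.
Qed.

Lemma eq_reduce f g b : f =1 g -> reduce f b = reduce g b.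
Proof.
elim/list2_ind: b f g => [|i|i j d IH] f g e /=; rewrite ?e //.
  by congr (_ - _ * _); apply: eq_shift => ?.
by congr (_ - _ * _ - _ * _ + _ * _); rewrite ?(IH f g) //; try apply: eq_shift => ?;
  apply: IH => s; rewrite e.
Qed.

Lemma reduce_lin3 x y f g h b :
  reduce (fun s => f s + x * g s + y * h s) b = reduce f b + x * reduce g b + y * reduce h b.
Proof.
elim/list2_ind: b f g h => [//|j|i j d IH] f g h /=; first by case: j => [|j] /=; ring.
by rewrite !IH; case: i => [|i]; case: j => [|j] /=; rewrite ?IH; ring.
Qed.

Lemma reduce0 r : reduce (fun=> 0) r = 0.
Proof.
elim/list2_ind: r => [//|j|i j d IH] /=; rewrite ?IH; first by case: j => [|j] /=; ring.
by case: i => [|i]; case: j => [|j] /=; rewrite ?IH; ring.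
Qed.

Lemma reduceZ x f r : reduce (fun s => x * f s) r = x * reduce f r.
Proof.
elim/list2_ind: r f => [//|j|i j d IH] f /=; first by case: j => [|j] /=; ring.
by rewrite !IH; case: i => [|i]; case: j => [|j] /=; rewrite ?IH; ring.
Qed.

Lemma reduce_add f g r : reduce (fun s => f s + g s) r = reduce f r + reduce g r.
Proof.
rewrite -[X in X + _]mul1r -reduceD; apply: eq_reduce => s; by rewrite mul1r.
Qed.

End Ops.

(* [geo u g] is the coefficient sequence of (u - Y)^-1 * sum_i g i * Y^i. *)
Fixpoint geo (u : rat) (g : nat -> rat) (i : nat) : rat :=
  if i is i'.+1 then u^-1 * (g i + geo u g i') else u^-1 * g 0%N.

Lemma geoD u x f g i :
  geo u (fun s => x * f s + g s) i = x * geo u f i + geo u g i.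
Proof. by elim: i => [|i IH] /=; rewrite ?IH; ring. Qed.

Lemma eq_geo u f g i : f =1 g -> geo u f i = geo u g i.
Proof. by move=> e; elim: i => [|i IH] /=; rewrite ?IH !e. Qed.

Lemma geo_shift u f i : geo u (shift f) i = shift (geo u f) i.
Proof.
by elim: i => [|[|i] IH] //=; rewrite ?mulr0 ?addr0 //; move: IH => /= ->.
Qed.

(** * Comparison of the odd-even sums for N with the even-odd sums for N + 1 *)

Section Transport.
Variable N : nat.
Let t : rat := N%:R^-1.

Definition rho a b := reduce t (block_tail N a) b.

Section Rho.
Variables (a : nat) (aN : (a.+1 < N)%N).
Variables (u v : rat) (uE : u = (N - a.+1)%N%:R) (vE : v = a.+1%:R).

Lemma gap_neq0 : u != 0. Proof. by rewrite uE pnatr_eq0 subn_eq0 -ltnNge. Qed.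
Lemma pos_neq0 : v != 0. Proof. by rewrite vE pnatr_eq0. Qed.
Lemma gapD_inv : t = (u + v)^-1. Proof. by rewrite /t uE vE -natrD subnK // ltnW. Qed.
Lemma gapD_neq0 : u + v != 0.
Proof. by rewrite uE vE -natrD subnK ?pnatr_eq0 ?(ltnW aN) //; case: N aN. Qed.

Let R b i j d := reduce t (fun s => block_tail N b [:: i, j & s]) d.

(** In series, the recursion of [block_tail] reads (1 - Y/u) R_a = (1 + Y/v) R_(a+1) + v^-(j+2)
    rho_(a+1), and (1 + Y/v) / (1 - Y/u) = - u/v + ((u + v) u / v) / (u - Y). *)
Lemma reduce_block_tail_rec i j d :
  R a i j d = - (u / v) * R a.+1 i j d + (u + v) * u / v * geo u (fun i => R a.+1 i j d) i
    + u^-1 ^+ i * v^-1 ^+ j.+2 * rho a.+1 d.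
Proof.
have u0 := gap_neq0; have v0 := pos_neq0.
elim: i => [|i IH] /=.
  transitivity (R a.+1 0 j d + v^-1 ^+ j.+2 * rho a.+1 d).
    rewrite -[R a.+1 _ _ _]addr0 -(mul0r (R a.+1 0%N j d)) -reduce_lin3; apply: eq_reduce => s.
    by rewrite block_tail_rec0 // mul0r addr0 vE exprVn.
  by field; rewrite u0 v0.
transitivity (R a.+1 i.+1 j d + v^-1 * R a.+1 i j d + u^-1 * R a i j d).
  rewrite -reduce_lin3; apply: eq_reduce => s; rewrite block_tail_recS // uE vE. reflexivity.
rewrite IH [u^-1 ^+ i.+1]exprS; set g := geo _ _ _; set w := _ ^+ j.+2; set w' := _ ^+ i.
by field; rewrite u0 v0.
Qed.

(** Without the term that drops the first pair, that pair acts through the single factor 1 - t X - t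
    Y. *)
Definition rho_proper b i j d := rho b [:: i, j & d]
  - t ^+ 2 * ((i == 0%N) && (j == 0%N))%:R * rho b d.

Lemma rho_properE b i j d : rho_proper b i j d = R b i j d - t * shift (fun i => R b i j d) i
  - t * shift (fun j => R b i j d) j.
Proof. by rewrite /rho_proper /rho /= addrK. Qed.

Lemma rhoE b i j d : rho b [:: i, j & d] = rho_proper b i j d
  + t ^+ 2 * ((i == 0%N) && (j == 0%N))%:R * rho b d.
Proof. by rewrite /rho_proper subrK. Qed.

Lemma geo_delta x i : geo x (fun i => (i == 0%N)%:R) i = x^-1 ^+ i.+1.
Proof. by elim: i => [|i IH] /=; rewrite ?mulr1 ?add0r // IH -exprS. Qed.

(* With L f (a) = f (a) + (u/v) f (a+1), M = u/(tv), V = (v - X)^-1 and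
   W = (u - Y)^-1 acting on the block exponents (Y for i, X for j), this reads
   L (rho_12 - t^2 rho_2) = M (W rho_12 + t^2 V rho_2). *)
Lemma rho_rec i j d :
  rho_proper a i j d + u / v * rho_proper a.+1 i j d = u / (t * v)
    * (geo u (fun i => rho a.+1 [:: i, j & d]) i
       + t ^+ 2 * ((i == 0%N)%:R * (v^-1 ^+ j.+1 * rho a.+1 d))).
Proof.
have u0 := gap_neq0; have v0 := pos_neq0; have uv0 := gapD_neq0.
have -> : geo u (fun i => rho a.+1 [:: i, j & d]) i =
   geo u (fun i => R a.+1 i j d) i - t * shift (geo u (fun i => R a.+1 i j d)) i
   - t * shift (fun j => geo u (fun i => R a.+1 i j d) i) j
   + t ^+ 2 * (j == 0%N)%:R * rho a.+1 d * u^-1 ^+ i.+1.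
  rewrite -geo_delta -geo_shift.
  transitivity (geo u (fun i => (t ^+ 2 * (j == 0%N)%:R * rho a.+1 d) * (i == 0%N)%:R
    + (- t * shift (fun j => R a.+1 i j d) j
    + (- t * shift (fun i => R a.+1 i j d) i + R a.+1 i j d))) i).
    apply: eq_geo => k; rewrite rhoE rho_properE -mulnb natrM; ring.
  rewrite !geoD; have -> : geo u (fun i => shift (fun j => R a.+1 i j d) j) i
    = shift (fun j => geo u (fun i => R a.+1 i j d) i) j.
    by case: j => [|j] //=; elim: {d}i => [|i IH] /=; rewrite ?IH; ring.
  ring.
(* By [reduce_block_tail_rec], L R = M W R + (u/v) W V rho_2. Multiplying by 1 - t X - t Y = t ((u -
   Y) + (v - X)) turns W V into t (V + W), and the W part completes [rho_proper] to [rho]. *)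
rewrite !rho_properE gapD_inv.
case: i => [|i]; case: j => [|j]; rewrite /= !reduce_block_tail_rec /= ?[_ ^+ _.+1]exprS ?expr0;
  set r := rho _ _; try set x := u^-1 ^+ i; try set y := v^-1 ^+ j.
- by field; rewrite ?uv0 ?u0 ?v0.
- by field; rewrite ?uv0 ?u0 ?v0.
- by field; rewrite ?uv0 ?u0 ?v0.
- by field; rewrite ?uv0 ?u0 ?v0.
Qed.
End Rho.

(* The factor (N - a - Y)/(N - a) turns the recursion in a of the sums for N + 1
   into the one of the sums for N. *)
Definition ffirst a i s := block_tail N.+1 a (i :: s)
  - (N - a)%N%:R^-1 * shift (fun i => block_tail N.+1 a (i :: s)) i.

(** At a = 0 the factor in [ffirst] is 1 - t Y, so this is the even-odd sum for N + 1. The value 1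
    on [::] is that of [rho]. *)
Definition chi a b := if b is i :: r then reduce t (ffirst a i) r else 1.

(** N - a is also the gap N + 1 - (a + 1) in [block_tail_recS], so the factor in [ffirst] removes
    the one term that stays at [a]. *)
Lemma ffirst_rec a i j d : (a < N)%N ->
  ffirst a i [:: j & d] = block_tail N.+1 a.+1 [:: i, j & d]
    + a.+1%:R^-1 * shift (fun i => block_tail N.+1 a.+1 [:: i, j & d]) i
    + (i == 0%N)%:R * (a.+1%:R^-1 ^+ j.+2 * block_tail N.+1 a.+1 d).
Proof.
move=> aN; rewrite /ffirst; case: i => [|i] /=.
  by rewrite block_tail_rec0 // exprVn mul1r !mulr0 subr0 addr0.
by rewrite block_tail_recS // subSS mul0r addr0 addrK.
Qed.

Lemma geo_ffirst a i s : (a < N)%N ->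
  block_tail N.+1 a (i :: s) = (N - a)%N%:R * geo (N - a)%N%:R (fun i => ffirst a i s) i.
Proof.
move=> aN; have u0 : (N - a)%N%:R != 0 :> rat by rewrite pnatr_eq0 subn_eq0 -ltnNge.
elim: i => [|i IH] /=; first by rewrite mulrA divff // mul1r /ffirst mulr0 subr0.
by rewrite mulrA divff // mul1r {1}/ffirst /= IH mulKf // subrK.
Qed.

Section Chi.
Let X b i r := reduce t (fun s => block_tail N.+1 b (i :: s)) r.

Definition chi_proper b i j k d := chi b [:: i, j, k & d]
  - t ^+ 2 * ((j == 0%N) && (k == 0%N))%:R * chi b (i :: d).

Lemma chiE b i j k d : chi b [:: i, j, k & d] = chi_proper b i j k d
  + t ^+ 2 * ((j == 0%N) && (k == 0%N))%:R * chi b (i :: d).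
Proof. by rewrite /chi_proper subrK. Qed.

Let X0 b i j k d := reduce t (fun s => block_tail N.+1 b [:: i, j, k & s]) d
  - t * shift (fun j => reduce t (fun s => block_tail N.+1 b [:: i, j, k & s]) d) j
  - t * shift (fun k => reduce t (fun s => block_tail N.+1 b [:: i, j, k & s]) d) k.

Let X0E b i j k d : X0 b i j k d = X b i [:: j, k & d]
  - t ^+ 2 * ((j == 0%N) && (k == 0%N))%:R * X b i d.
Proof. by rewrite /X /= addrK. Qed.

Lemma reduce_geo u (g : nat -> seq nat -> rat) i r :
  reduce t (fun s => geo u (fun i => g i s) i) r
  = geo u (fun i => reduce t (g i) r) i.
Proof.
elim: i => [|i IH] /=.
  by rewrite -reduceZ.
by rewrite -IH -reduce_add -reduceZ.
Qed.

Lemma X_geo b i r : (b < N)%N ->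
  X b i r = (N - b)%N%:R * geo (N - b)%N%:R (fun i => chi b (i :: r)) i.
Proof.
move=> bN; rewrite /= -reduce_geo -reduceZ.
by apply: eq_reduce => s; rewrite geo_ffirst.
Qed.

Lemma reduce_shift (g : nat -> seq nat -> rat) i r :
  reduce t (fun s => shift (fun i => g i s) i) r = shift (fun i => reduce t (g i) r) i.
Proof. by case: i => [|i] //=; exact: reduce0. Qed.

Lemma chi_proper_raw a i j k d : (a < N)%N ->
  let v : rat := a.+1%:R in
  chi_proper a i j k d = X0 a.+1 i j k d + v^-1 * shift (fun i => X0 a.+1 i j k d) i
    + (i == 0%N)%:R * (v^-1 ^+ j.+2 * X a.+1 k d
       - t * shift (fun j => v^-1 ^+ j.+2 * X a.+1 k d) j
       - t * (v^-1 ^+ j.+2 * shift (fun k => X a.+1 k d) k)).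
Proof.
move=> aN v.
have E j' k' : reduce t (fun s => ffirst a i [:: j', k' & s]) d =
   reduce t (fun s => block_tail N.+1 a.+1 [:: i, j', k' & s]) d
   + v^-1 * shift (fun i => reduce t (fun s => block_tail N.+1 a.+1 [:: i, j', k' & s]) d) i
   + (i == 0%N)%:R * v^-1 ^+ j'.+2 * X a.+1 k' d.
  rewrite -reduce_shift -reduce_lin3; apply: eq_reduce => s.
  by rewrite ffirst_rec // mulrA.
rewrite /chi_proper /chi /= addrK E /X0.
by case: i E => [|i] E; case: j => [|j]; case: k => [|k]; rewrite /= ?E /=; ring.
Qed.

Lemma geoB_delta u x (f g : nat -> rat) i :
  geo u (fun i => f i - x * g i) i = geo u f i - x * geo u g i.
Proof. by elim: i => [|i IH] /=; rewrite ?IH; ring. Qed.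

Lemma shift_geo u g i : u != 0 -> shift (geo u g) i = u * geo u g i - g i.
Proof. by case: i => [|i] u0 /=; rewrite mulrA divff // mul1r; ring. Qed.

Section ChiRec.
Variables (a : nat) (aN : (a.+1 < N)%N).
Variables (u v : rat) (uE : u = (N - a.+1)%N%:R) (vE : v = a.+1%:R).

(* In the notation of [rho_rec]:
   L (chi_12 - t^2 chi_13) = M (W_1 (chi_12 - t^2 chi_13) + t^2 (V_1 + W_2) chi_2). *)
Lemma chi_rec i j k d :
  chi_proper a i j k d + u / v * chi_proper a.+1 i j k d = u / (t * v)
    * (geo u (fun i => chi_proper a.+1 i j k d) i
       + t ^+ 2 * ((i == 0%N)%:R * (v^-1 ^+ j.+1 * chi a.+1 (k :: d)
           + (j == 0%N)%:R * geo u (fun k => chi a.+1 (k :: d)) k))).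
Proof.
have u0 : u != 0 by rewrite (gap_neq0 aN uE).
have v0 : v != 0 by rewrite (pos_neq0 vE).
have uv0 : u + v != 0 by rewrite (gapD_neq0 aN uE vE).
have tuv : t = (u + v)^-1 by exact: (gapD_inv aN uE vE).
(* The factor of [chi] at a + 1 is 1 - Y/u, and dividing by it is u W_1. *)
have X0g i' : X0 a.+1 i' j k d = u * geo u (fun i => chi_proper a.+1 i j k d) i'.
  rewrite X0E !X_geo // -uE.
  have E : geo u (fun i => chi_proper a.+1 i j k d) i' = _ := (geoB_delta u (t ^+ 2 * ((j == 0%N) && (k == 0%N))%:R)
      (fun i => chi a.+1 [:: i, j, k & d]) (fun i => chi a.+1 (i :: d)) i').
  rewrite E.
  by ring.
(* The homogeneous part is (1 + Y/v) u W_1 + u/v = M W_1. In the terms with i = 0, the pair (j, k)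
   meets the pole V_1 of the block ending in j and the pole W_2 of the block starting with k, and 1
   - t X_1 - t Y_2 = t ((v - X_1) + (u - Y_2)) splits V_1 W_2. *)
rewrite chi_proper_raw ?(ltnW aN) // -vE X0g.
rewrite (eq_shift _ X0g) X_geo // -uE (@eq_shift (fun k => X a.+1 k d)
    (fun k => u * geo u (fun k => chi a.+1 (k :: d)) k)); last first.
  by move=> k'; rewrite X_geo // -uE.
have shift_geoZ g m : shift (fun i => u * geo u g i) m = u * (u * geo u g m - g m).
  by rewrite -shift_geo //; case: m => [|m] //=; rewrite mulr0.
rewrite !shift_geoZ tuv; move: (geo u _ i) (geo u _ k) => G P.
by case: j {X0g} => [|j]; rewrite /= !(exprS v^-1) ?expr0;
  try set w := v^-1 ^+ j; field; rewrite ?uv0 ?u0 ?v0.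
Qed.

(** The last entry is unpaired: its factor 1 - t X = t ((v - X) + u) puts the constant 1/u in the
    place of W_2. *)
Lemma chi_rec_pair i j :
  chi a [:: i; j] + u / v * chi a.+1 [:: i; j] = u / (t * v)
    * (geo u (fun i => chi a.+1 [:: i; j]) i
       + t ^+ 2 * ((i == 0%N)%:R * (v^-1 ^+ j.+1 + (j == 0%N)%:R / u))).
Proof.
have u0 : u != 0 by rewrite (gap_neq0 aN uE).
have v0 : v != 0 by rewrite (pos_neq0 vE).
have uv0 : u + v != 0 by rewrite (gapD_neq0 aN uE vE).
have tuv : t = (u + v)^-1 by exact: (gapD_inv aN uE vE).
pose Y i := block_tail N.+1 a.+1 [:: i; j] - t * shift (fun j => block_tail N.+1 a.+1 [:: i; j]) j.
have YE i' : Y i' = u * geo u (fun i => chi a.+1 [:: i; j]) i'.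
  by rewrite uE; exact: (X_geo i' [:: j] aN).
have -> : chi a [:: i; j] = Y i + v^-1 * shift Y i
    + (i == 0%N)%:R * (v^-1 ^+ j.+2 - t * shift (fun j => v^-1 ^+ j.+2) j).
  rewrite /Y vE; case: i => [|i]; case: (j) => [|j']; rewrite /= !ffirst_rec ?(ltnW aN) //= /block_tail /=;
    ring.
have shift_geoZ g m : shift (fun i => u * geo u g i) m = u * (u * geo u g m - g m).
  by rewrite -shift_geo //; case: m => [|m] //=; rewrite mulr0.
rewrite (eq_shift _ YE) shift_geoZ YE tuv; move: (geo u _ i) => G.
by case: (j) => [|j'] /=; rewrite !(exprS v^-1) ?expr0;
  try set w := v^-1 ^+ j'; field; rewrite ?uv0 ?u0 ?v0.
Qed.

End ChiRec.
End Chi.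

Arguments chi a b : simpl never.

Lemma rho_last i j d : (0 < N)%N ->
  rho N.-1 [:: i, j & d] = t ^+ 2 * ((i == 0%N) && (j == 0%N))%:R * rho N.-1 d.
Proof.
move=> N0; have Z i' j' : reduce t (fun s => block_tail N N.-1 [:: i', j' & s]) d = 0.
  by rewrite -[RHS](reduce0 t d); apply: eq_reduce => s; rewrite block_tail0 //; lia.
by rewrite /rho /=; case: (i) => [|i']; case: (j) => [|j']; rewrite /= !Z; ring.
Qed.

(** Dropping pairs keeps the length of r odd, so a first block always remains, and its range N < n <
    N + 1 is empty. *)
Lemma reduce_block_tail_end k r : odd (size r) ->
  reduce t (fun s => block_tail N.+1 N (k :: s)) r = 0.
Proof.
elim/list2_ind: r => [//|l _|l m r IH] /=.
  by case: l => [|l] /=; rewrite !block_tail0 //; ring.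
rewrite negbK => /IH Z'.
have Z l' m' : reduce t (fun s => block_tail N.+1 N [:: k, l', m' & s]) r = 0.
  by rewrite -[RHS](reduce0 t r); apply: eq_reduce => s; rewrite block_tail0.
by case: l => [|l]; case: m => [|m]; rewrite /= !Z ?Z'; ring.
Qed.

Lemma chi_proper_last i j k r : (0 < N)%N -> odd (size r) -> chi_proper N.-1 i j k r = 0.
Proof.
move=> N0 /reduce_block_tail_end Z1; rewrite chi_proper_raw; last by lia.
have Z3 i' j' k' : reduce t (fun s => block_tail N.+1 N [:: i', j', k' & s]) r = 0.
  by rewrite -[RHS](reduce0 t r); apply: eq_reduce => s; rewrite block_tail0.
rewrite (ltn_predK N0).
by case: i => [|i]; case: j => [|j]; case: k => [|k]; rewrite /= !Z3 !Z1; ring.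
Qed.

(** Both sides are [t ^+ size b] when every entry is 0, and 0 otherwise. On the chi side only n = N
    remains, and the last entry j contributes t^(j+2) - t t^(j+1), which vanishes for j > 0. *)
Lemma rho_chi_last b : (0 < N)%N -> ~~ odd (size b) -> rho N.-1 b = chi N.-1 b.
Proof.
move=> N0; have [n] := ubnP (size b); elim: n b => // n IHn b sb ob.
case: b sb ob => [//|i [//|j d]] /= sb ob; rewrite rho_last //.
case: d sb ob => [|k [//|l d]] /= sb ob.
  have ffE k l : ffirst N.-1 k [:: l] = (k == 0%N)%:R * t ^+ l.+2.
    rewrite ffirst_rec ?(ltn_predK N0); last by lia.
    by case: k => [|k] /=; rewrite !block_tail0 // /block_tail /= /t; ring.
  rewrite /rho /chi /= !ffE /block_tail /=.
  by case: (i) => [|i']; case: (j) => [|j']; rewrite /= ?ffE /= ?exprS; ring.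
rewrite chiE chi_proper_last //; last by rewrite /=; lia.
rewrite -IHn //=; try lia.
rewrite !rho_last //.
by case: (i == _); case: (j == _); case: (k == _); case: (l == _) => /=; ring.
Qed.

(* Induction on the length of b, then downward on a: substituting [rho_rec] three
   times shows that rho satisfies the recursion [chi_rec] of chi. *)
Lemma rho_chi a b : (a < N)%N -> ~~ odd (size b) -> rho a b = chi a b.
Proof.
have [n] := ubnP (size b); elim: n b a => // n IHn b a sb aN ob.
have [e ae] : exists e, (a + e = N.-1)%N by exists (N.-1 - a)%N; lia.
elim: e a b ae aN sb ob => [|e IHe] a b ae aN sb ob.
  by rewrite addn0 in ae; rewrite ae rho_chi_last //; lia.
have aN' : (a.+1 < N)%N by lia.
case: b sb ob => [//|i [//|j d]] /= sb ob.
have [u uE] : exists u : rat, u = (N - a.+1)%N%:R by eexists.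
have [v vE] : exists v : rat, v = a.+1%:R by eexists.
have u0 : u != 0 by rewrite (gap_neq0 aN' uE).
have v0 : v != 0 by rewrite (pos_neq0 vE).
have uv0 : u + v != 0 by rewrite (gapD_neq0 aN' uE vE).
have tuv : t = (u + v)^-1 by exact: (gapD_inv aN' uE vE).
have IH1 b' : (size b' < n.+1)%N -> ~~ odd (size b') -> chi a.+1 b' = rho a.+1 b'.
  by move=> ? ?; rewrite IHe //; lia.
have IH0 b' : (size b' < n)%N -> ~~ odd (size b') -> chi a b' = rho a b'.
  by move=> ? ?; rewrite IHn.
have Er := rho_rec aN' uE vE.
have R1 i' d' : rho a.+1 [:: i', j & d'] = rho_proper a.+1 i' j d'
   + t ^+ 2 * ((i' == 0%N) && (j == 0%N))%:R * rho a.+1 d' by exact: rhoE.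
case: d sb ob => [|k [//|l d]] /= sb ob.
  have := chi_rec_pair aN' uE vE i j.
  rewrite (eq_geo u i (fun i => IH1 [:: i; j] sb isT)) IH1 // rhoE.
  have := Er i j [::]; rewrite !rhoE tuv; move: (geo _ _ _) (rho_proper _ _ _ _) (rho_proper _ _ _ _) => G r1 r0.
  move=> /(canRL (addrK _)) -> /(canRL (addrK _)) ->; rewrite /rho /= /block_tail /=.
  by case: (i); case: (j); rewrite /= ?expr0 ?exprS => *; field; rewrite ?uv0 ?u0 ?v0.
have C0 i' : chi_proper a.+1 i' j k (l :: d) = rho a.+1 [:: i', j, k, l & d]
   - t ^+ 2 * ((j == 0%N) && (k == 0%N))%:R * rho a.+1 [:: i', l & d].
  by rewrite /chi_proper !IH1 //=; lia.
have G2 : geo u (fun k => chi a.+1 [:: k, l & d]) k = geo u (fun k => rho a.+1 [:: k, l & d]) k.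
  by apply: eq_geo => k'; rewrite IH1 //=; lia.
have := chi_rec aN' uE vE i j k (l :: d).
rewrite (eq_geo u i C0) geoB_delta G2 C0 IH1 /=; try lia.
(* By [rho_rec], L rho - M W rho at [:: i, l & d] depends on i only through i == 0. Comparing it
   with the value at [:: k, l & d] exchanges W_1 on the list without j, k for W_2 on the list
   without i, j, which is all that separates the recursion at (i, j) from [chi_rec]. *)
have := Er i j [:: k, l & d]; have := Er i l d; have := Er k l d.
rewrite chiE IH0 /=; try lia.
rewrite !rhoE; move: (u / (t * v)) (u / v) (geo _ _ _) (geo _ _ _) (geo _ _ _) => M w G G' G''.
move: (rho_proper a i j _) (rho_proper a.+1 i j _) (rho_proper a i l d) (rho_proper a.+1 i l d) (rho_proper a k l d)
  (rho_proper a.+1 k l d) (rho a d) (rho a.+1 d) => r1 r1' r2 r2' r3 r3' r r'.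
do 4![move=> /(canRL (addrK _)) ->].
case: (i == _); case: (j == _); case: (k == _); case: (l == _); rewrite /=; ring.
Qed.
End Transport.

Theorem reduce_block_tail N b : (0 < N)%N -> ~~ odd (size b) -> b != [::] ->
  reduce N%:R^-1 (block_tail N 0) b = reduce_tail N%:R^-1 (block_tail N.+1 0) b.
Proof.
move=> N0 sb; rewrite -/(rho N 0 b) rho_chi //; case: b {sb} => [//|i r] _.
by rewrite /chi /reduce_tail; apply: eq_reduce => s; rewrite /ffirst subn0.
Qed.

(** * Sums over pairs of sets as sums over bit sequences *)

(** In this form a sum over sets unfolds one entry at a time, in step with [reduce]. *)
Fixpoint sumseq (T : finType) (n : nat) (F : seq T -> rat) : rat :=
  if n is n'.+1 then \sum_(x : T) sumseq n' (fun s => F (x :: s)) else F [::].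

Lemma eq_sumseq (T : finType) n (F G : seq T -> rat) :
  (forall s, size s = n -> F s = G s) -> sumseq n F = sumseq n G.
Proof.
elim: n F G => [|n IH] F G e /=; first exact: e.
by apply: eq_bigr => x _; apply: IH => s sn; apply: e; rewrite /= sn.
Qed.

Lemma sumseqZ (T : finType) n x (F : seq T -> rat) :
  sumseq n (fun s => x * F s) = x * sumseq n F.
Proof.
elim: n F => [|n IH] F //=; rewrite big_distrr /=.
by apply: eq_bigr => y _; rewrite IH.
Qed.

Lemma sumseq_sum (T I : finType) n (F : I -> seq T -> rat) :
  sumseq n (fun s => \sum_i F i s) = \sum_i sumseq n (F i).
Proof.
elim: n F => [|n IH] F //=; rewrite exchange_big /=.
by apply: eq_bigr => y _; rewrite IH.
Qed.

Lemma sum_tuple (T : finType) n (F : seq T -> rat) :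
  \sum_(t : n.-tuple T) F t = sumseq n F.
Proof.
elim: n F => [|n IH] F /=.
  by rewrite (big_pred1 [tuple]) // => t; apply/esym/eqP; rewrite [LHS]tuple0.
rewrite -(eq_bigr _ (fun x _ => IH (fun s => F (x :: s)))).
rewrite pair_bigA /= (reindex (fun p : T * n.-tuple T => [tuple of p.1 :: p.2])) //=.
exists (fun t => (thead t, [tuple of behead t])) => [[x t] _|t _] /=.
  by rewrite theadE; congr (_, _); apply: val_inj.
by apply: val_inj; rewrite /= [in RHS](tuple_eta t).
Qed.

Definition bits n (A : {set 'I_n}) : seq bool := [tuple i \in A | i < n].

Lemma size_bits n (A : {set 'I_n}) : size (bits A) = n.
Proof. exact: size_tuple. Qed.

Lemma nth_bits n (A : {set 'I_n}) (i : 'I_n) : nth false (bits A) i = (i \in A).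
Proof. by rewrite -tnth_nth tnth_mktuple. Qed.

Lemma sum_set n (F : seq bool -> rat) :
  \sum_(A : {set 'I_n}) F (bits A) = sumseq n F.
Proof.
rewrite -sum_tuple (reindex (fun A : {set 'I_n} => [tuple i \in A | i < n])) //=.
exists (fun t : n.-tuple bool => [set i | tnth t i]) => [A _|t _].
  by apply/setP=> i; rewrite inE tnth_mktuple.
by apply: eq_from_tnth => i; rewrite tnth_mktuple inE.
Qed.

Lemma sum_ffun (T : finType) n (F : seq T -> rat) :
  \sum_(f : {ffun 'I_n -> T}) F [tuple f i | i < n] = sumseq n F.
Proof.
rewrite -sum_tuple (reindex (fun f : {ffun 'I_n -> T} => [tuple f i | i < n])) //=.
exists (fun t : n.-tuple T => [ffun i => tnth t i]) => [A _|t _].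
  by apply/ffunP=> i; rewrite ffunE tnth_mktuple.
by apply: eq_from_tnth => i; rewrite tnth_mktuple ffunE.
Qed.

Lemma count_bits n (A : {set 'I_n}) : count id (bits A) = #|A|.
Proof.
rewrite /bits /= -sum1_card -sum1_count big_map /= big_enum_cond /=.
by apply: eq_bigl => i.
Qed.

Lemma memb_bits n (A : {set 'I_n}) k : memb A k = (0 < k)%N && nth false (bits A) k.-1.
Proof.
apply/existsP/andP => [[j /andP[/eqP <- jA]]|[k0 Ak]].
  by rewrite /pos /= nth_bits.
case: (ltnP k.-1 n) => kn; last by rewrite nth_default ?size_bits in Ak.
exists (Ordinal kn); rewrite /pos /= prednK // eqxx /=.
by rewrite -nth_bits.
Qed.

(** The odd-even condition on bits: the 1-based positions 2r - 1 and 2r agree, and a last unmatched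
    position, whose partner lies outside, is absent. *)
Fixpoint paired (s : seq bool) : bool :=
  match s with
  | a :: b :: s' => (a == b) && paired s'
  | [:: a] => ~~ a
  | [::] => true
  end.

Fixpoint unpaired (s : seq bool) : bool :=
  if s is a :: (b :: s') then ~~ (a && b) && unpaired s' else true.

Lemma pairedP (s : seq bool) :
  reflect (forall i, nth false s i -> nth false s (if odd i then i.-1 else i.+1)) (paired s).
Proof.
apply: (iffP idP); elim/list2_ind: s => [|a|a b s IH] //=.
- by move=> _ i; rewrite nth_nil.
- by move/negbTE=> -> [|[|i]].
- case/andP=> /eqP <- /IH H [|[|i]] //=; rewrite negbK => /H.
  by case: (boolP (odd i)) => //; case: i.
- by move=> /(_ 0%N) /=; case: a => // /(_ isT).
- move=> H; apply/andP; split.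
    by move: (H 0%N) (H 1%N) => /=; case: (a); case: (b) => //= H0 H1; move: (H0 isT) || move: (H1 isT).
  apply: IH => i; have := H i.+2; rewrite /= negbK.
  by case: (boolP (odd i)) => //; case: i.
Qed.

Lemma unpairedP (s : seq bool) :
  reflect (forall i, nth false s i -> ~~ odd i -> ~~ nth false s i.+1) (unpaired s).
Proof.
apply: (iffP idP); elim/list2_ind: s => [|a|a b s IH] //=.
- by move=> _ i; rewrite nth_nil.
- case/andP=> nab /IH H [|[|i]] //=; last by rewrite negbK => /H.
  by move=> a1; rewrite a1 in nab.
- move=> H; apply/andP; split.
    by have := H 0%N => /=; case: (a) => // /(_ isT isT).
  by apply: IH => i; have := H i.+2; rewrite /= negbK.
Qed.

Lemma odd_even_bits n (A : {set 'I_n}) : odd_even A = paired (bits A).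
Proof.
apply/forall_inP/pairedP => H i.
  case: (ltnP i n) => [lt_in|]; last by move=> ni; rewrite nth_default ?size_bits.
  rewrite (nth_bits A (Ordinal lt_in)) => /H; rewrite /pos /= !memb_bits /=.
  by case: (boolP (odd i)) => //= _ /andP[].
rewrite -nth_bits => /H; rewrite /pos /= !memb_bits /=.
by case: (boolP (odd i)) => //=; case: (i : nat).
Qed.

(** The partner of position 1 would be 0, which [memb] rejects. Once the first bit is removed, the
    pairs {2r, 2r + 1} become those of [paired]. *)
Lemma even_odd_bits n (A : {set 'I_n.+1}) :
  even_odd A = ~~ head false (bits A) && paired (behead (bits A)).
Proof.
have hE : head false (bits A) = nth false (bits A) 0 by rewrite nth0.
apply/forall_inP/andP => [H|[]].
  have H' i : nth false (bits A) i ->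
      if odd i then nth false (bits A) i.+1 else (0 < i)%N && nth false (bits A) i.-1.
    case: (ltnP i n.+1) => [lt_in|]; last by move=> ni; rewrite nth_default ?size_bits.
    rewrite (nth_bits A (Ordinal lt_in)) => /H; rewrite /pos /= !memb_bits /=.
    by case: (boolP (odd i)).
  split; first by rewrite hE; apply/negP => /H'.
  apply/pairedP => i; rewrite !nth_behead => /H' /=.
  by case: (boolP (odd i)) => //; case: i.
rewrite hE => A0 /pairedP H i; rewrite -nth_bits /pos /= !memb_bits /=.
case: i => -[|i] lt_in /=; first by rewrite (negbTE A0).
rewrite -nth_behead => /H; rewrite nth_behead.
by case: (boolP (odd i)) => //=; case: (i).
Qed.

Lemma noOE_bits n (B : {set 'I_n}) : noOE B = unpaired (bits B).
Proof.
apply/forall_inP/unpairedP => H i.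
  case: (ltnP i n) => [lt_in|]; last by move=> ni; rewrite nth_default ?size_bits.
  rewrite (nth_bits B (Ordinal lt_in)) => /H; rewrite /pos /= memb_bits /=.
  by case: (odd i).
rewrite -nth_bits => /H; rewrite /pos /= memb_bits /=.
by case: (odd i) => // /(_ isT).
Qed.

Lemma noEO_bits n (B : {set 'I_n}) : noEO B = unpaired (behead (bits B)).
Proof.
apply/forall_inP/unpairedP => H i.
  rewrite !nth_behead; case: (ltnP i.+1 n) => [lt_in|]; last by move=> ni; rewrite nth_default ?size_bits.
  rewrite (nth_bits B (Ordinal lt_in)) => /H; rewrite /pos /= memb_bits /=.
  by case: (odd i).
rewrite -nth_bits /pos /= negbK memb_bits /=; case: i => -[|i] lt_in //=.
rewrite -nth_behead => /H; rewrite nth_behead.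
by case: (odd i) => // /(_ isT).
Qed.

Lemma sumseq_eq0 (T : finType) n (F : seq T -> rat) :
  (forall s, size s = n -> F s = 0) -> sumseq n F = 0.
Proof.
elim: n F => [|n IH] F F0 /=; first exact: F0.
by rewrite big1 // => x _; apply: IH => s sn; apply: F0; rewrite /= sn.
Qed.

Fixpoint dropseq (c : seq nat) (s r : seq bool) : seq nat :=
  match c, s, r with
  | x :: c', a :: s', b :: r' =>
      if a then dropseq c' s' r' else (x - b)%N :: dropseq c' s' r'
  | _, _, _ => [::]
  end.

Lemma dropseq_iota c s r : size s = size c -> size r = size c ->
  dropseq c s r = [seq (nth 0%N c i - nth false r i)%N | i <- iota 0 (size c) & ~~ nth false s i].
Proof.
elim: c s r => [|x c IH] [|a s] [|b r] //= [ss] [sr].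
rewrite (iotaDl 1 0) filter_map IH //.
by case: a => /=; rewrite -map_comp.
Qed.

Lemma cdrop_bits c (A B : {set 'I_(size c)}) : cdrop A B = dropseq c (bits A) (bits B).
Proof.
rewrite dropseq_iota ?size_bits // /cdrop -val_enum_ord filter_map -map_comp.
rewrite (@eq_filter _ _ (preim val (fun i => ~~ nth false (bits A) i))); last first.
  by move=> i /=; rewrite nth_bits.
by apply: eq_map => i /=; rewrite nth_bits.
Qed.

Definition is1 (c : seq nat) (s : seq bool) := all2 (fun x a => a ==> (x == 1)%N) c s.
Definition isbig (c : seq nat) (s : seq bool) := all2 (fun x a => a ==> (1 < x)%N) c s.

Lemma subset_bits (P : pred nat) c (A : {set 'I_(size c)}) :
  (A \subset [set i : 'I_(size c) | P (nth 0%N c i)]) = all2 (fun x a => a ==> P x) c (bits A).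
Proof.
rewrite all2E size_bits eqxx /=; apply/subsetP/(all_nthP (0%N, false)) => H i.
  rewrite size_zip size_bits minnn => lt_ic; rewrite nth_zip ?size_bits //=.
  by rewrite (nth_bits A (Ordinal lt_ic)); apply/implyP => /H; rewrite inE.
have := H i; rewrite size_zip size_bits minnn => /(_ (ltn_ord i)).
by rewrite nth_zip ?size_bits //= nth_bits inE => /implyP.
Qed.

Section Sums.
Variable t : rat.

Definition bit_weight (f : seq nat -> rat) c s r : rat :=
  (-1) ^+ count id r * (t ^+ (count id s + count id r) * f (dropseq c s r)).

Definition osum f c := sumseq (size c) (fun s => sumseq (size c) (fun r =>
  [&& is1 c s, paired s, isbig c r & unpaired r]%:R * bit_weight f c s r)).

Definition esum f c := sumseq (size c) (fun s => sumseq (size c) (fun r =>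
  [&& is1 c s, ~~ head false s && paired (behead s), isbig c r & unpaired (behead r)]%:R
    * bit_weight f c s r)).

Lemma osum_cons2 f x y c : osum f [:: x, y & c] =
  \sum_a \sum_a' \sum_b \sum_b'
    [&& a ==> (x == 1)%N, a' ==> (y == 1)%N, a == a', b ==> (1 < x)%N,
        b' ==> (1 < y)%N & ~~ (b && b')]%:R
    * (-1) ^+ (b + b') * t ^+ (a + a' + b + b')
    * osum (fun s => f (dropseq [:: x; y] [:: a; a'] [:: b; b'] ++ s)) c.
Proof.
rewrite /osum /=; apply: eq_bigr => a _; apply: eq_bigr => a' _.
rewrite sumseq_sum; apply: eq_bigr => b _; rewrite sumseq_sum; apply: eq_bigr => b' _.
rewrite -sumseqZ; apply: eq_sumseq => s ss; rewrite -sumseqZ; apply: eq_sumseq => r sr.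
rewrite /bit_weight.
have -> : dropseq [:: x, y & c] [:: a, a' & s] [:: b, b' & r] =
   dropseq [:: x; y] [:: a; a'] [:: b; b'] ++ dropseq c s r.
  by rewrite /=; case: (a); case: (a').
set D := dropseq [:: x; y] _ _; rewrite /is1 /isbig /= -!/(is1 _ _) -!/(isbig _ _).
set K := [&& a ==> _, a' ==> _, a == a', b ==> _, b' ==> _ & ~~ _].
rewrite (_ : [&& _, _, _ & _] = K && [&& is1 c s, paired s, isbig c r & unpaired r]); last first.
  rewrite /K /is1 /isbig; case: (a ==> _); case: (a' ==> _); case: (a == a'); case: (b ==> _);
  case: (b' ==> _); case: (~~ (b && b')); rewrite /= ?andbF ?andbT //.
rewrite -mulnb natrM /= !exprD; ring.
Qed.

(** On one pair the constraints leave the four terms of [reduce]: nothing, a decrement of either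
    entry, or both entries dropped. A dropped entry is 1, so it is never decremented as well. *)
Lemma osum_reduce f b : osum f (map succn b) = reduce t (f \o map succn) b.
Proof.
elim/list2_ind: b f => [|i|i j b IH] f.
- by rewrite /osum /= /bit_weight /= mulr1n !mul1r.
- rewrite /osum /= !big_bool /= /bit_weight /is1 /isbig /= !andbT !andbF /=.
  by case: i => [|i] /=; rewrite ?subn0 ?subn1 /=; ring.
rewrite osum_cons2 !big_bool /= !IH /= !eqSS !ltnS.
by case: i => [|i]; case: j => [|j]; rewrite /= ?subn0 ?subn1 /= /comp /=; ring.
Qed.

Lemma esum_reduce_tail f b : b != [::] -> esum f (map succn b) = reduce_tail t (f \o map succn) b.
Proof.
case: b => [//|i b] _.
have -> : esum f (map succn (i :: b)) = \sum_(b' : bool) (b' ==> (0 < i)%N)%:R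
    * (- t) ^+ b' * osum (fun s => f ((i.+1 - b')%N :: s)) (map succn b).
  rewrite /esum /= big_bool /= [X in X + _](_ : _ = 0) ?add0r; last first.
    apply: sumseq_eq0 => s _; rewrite big1 // => b' _; apply: sumseq_eq0 => r _.
    by rewrite !andbF mul0r.
  rewrite sumseq_sum; apply: eq_bigr => b' _.
  rewrite -sumseqZ; apply: eq_sumseq => s _; rewrite -sumseqZ; apply: eq_sumseq => r _.
  rewrite /bit_weight /is1 /isbig /=.
  rewrite ltnS -!/(is1 _ _) -!/(isbig _ _).
  set P := is1 _ _; set Q := isbig _ _.
  rewrite (_ : [&& P, _, _ & _] = (b' ==> (0 < i)%N) && [&& P, paired s, Q & unpaired r]); last first.
    by case: (b' ==> _); rewrite /= ?andbF.
  rewrite -mulnb natrM !exprD; case: b' => /=; ring.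
rewrite big_bool /= !osum_reduce /reduce_tail /= ?mul1r ?expr1 ?expr0 ?subn0 ?subn1 /=.
transitivity (reduce t (fun s => - t * shift (fun i' => f (i'.+1 :: map succn s)) i
   + f (i.+1 :: map succn s)) b); last by apply: eq_reduce => s /=; ring.
rewrite reduceD; case: i => [|i] /=; first by rewrite reduce0; ring.
by ring.
Qed.

End Sums.

Lemma sum_setE (c : seq nat) (P : pred {set 'I_(size c)}) (p : pred (seq bool)) (F : seq bool -> rat) :
  (forall A, P A = p (bits A)) ->
  \sum_(A : {set 'I_(size c)} | P A) F (bits A) = sumseq (size c) (fun s => (p s)%:R * F s).
Proof.
move=> e; rewrite -(sum_set (size c) (fun s => (p s)%:R * F s)) big_mkcond /=.
by apply: eq_bigr => A _; rewrite e; case: (p _); rewrite ?mul1r ?mul0r.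
Qed.

(** * Recursion for the sums zeta^diamond_N *)

Section Zeta.
Variable N : nat.

(** The bit is membership in A. For n > 0, the condition n - 1 < n' is the weak inequality that
    follows an index in A. *)
Definition zstep (p q : bool * 'I_N) : bool := (p.2 - p.1 < q.2)%N.

Definition zfactor (x : nat * (bool * 'I_N)) : rat :=
  if x.2.1 then (N - x.2.2)%N%:R^-1 else x.2.2%:R ^- x.1.

Definition zsum (P : pred (seq (bool * 'I_N))) (k : seq nat) : rat :=
  sumseq (size k) (fun s : seq bool => sumseq (size k) (fun n : seq 'I_N =>
    (is1 k s && P (zip s n))%:R * \prod_(x <- zip k (zip s n)) zfactor x)).

Lemma zsum_cons a k1 k :
  zsum (fun z => if z is q :: z' then (a < q.2)%N && path zstep q z' else true) (k1 :: k)
  = \sum_(m : 'I_N) \sum_(b : bool) ((a < m)%N && (b ==> (k1 == 1%N)))%:R * (zfactor (k1, (b, m))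
    * zsum (fun z => if z is q :: z' then (m - b < q.2)%N && path zstep q z' else true) k).
Proof.
rewrite exchange_big /= /zsum /=; apply: eq_bigr => b _.
rewrite sumseq_sum; apply: eq_bigr => m _; rewrite mulrA.
rewrite -sumseqZ; apply: eq_sumseq => s ss; rewrite -sumseqZ; apply: eq_sumseq => n sn.
rewrite big_cons /is1 /= -/(is1 _ _).
have -> : path zstep (b, m) (zip s n) =
   (if zip s n is q :: z' then (m - b < q.2)%N && path zstep q z' else true) by case: (zip s n).
set P := (if _ is _ :: _ then _ else _).
rewrite (_ : _ && _ = ((a < m)%N && (b ==> (k1 == 1%N))) && (is1 k s && P)); last first.
  by case: (b ==> _); case: (a < m)%N; rewrite /= ?andbF.
by rewrite -(mulnb (_ && _)) natrM; ring.
Qed.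

Lemma zsum_zeta_tail a k :
  zsum (fun z => if z is q :: z' then (a < q.2)%N && path zstep q z' else true) k
  = zeta_tail N a k.
Proof.
elim: k a => [|k1 k IH] a; first by rewrite /zsum /= big_nil mulr1.
rewrite zsum_cons /= big_geq_mkord [RHS]big_mkcond /=; apply: eq_bigr => m _.
rewrite big_bool /= !IH /zfactor /= subn0 subn1 andbT.
case: ltnP => am; last by rewrite !mul0r addr0.
by rewrite addrC mul1r; case: eqP => _; rewrite ?mul1r ?mul0r.
Qed.


Lemma zip_path r (A : {set 'I_r}) (n : {ffun 'I_r -> 'I_N}) :
  [forall i, 0 < n i]%N && [forall i : 'I_r, forall j : 'I_r, (val j == (val i).+1) ==>
     (if i \in A then (n i <= n j)%N else (n i < n j)%N)]
  = (if zip (bits A) [tuple n i | i < r] is q :: z' then (0 < q.2)%N && path zstep q z' else true).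
Proof.
set z := zip _ _.
have sz : size z = r by rewrite size_zip size_bits size_tuple minnn.
case: r A n @z sz => [|r] A n z sz.
  rewrite (size0nil sz); apply/andP; split; first by apply/forallP => -[].
  by apply/forallP => -[].
pose x0 : bool * 'I_N := (false, n ord0).
have zE (i : 'I_r.+1) : nth x0 z i = (i \in A, n i).
  by rewrite nth_zip ?size_bits ?size_tuple // nth_bits -tnth_nth tnth_mktuple.
case ez : z => [|q z']; first by rewrite ez in sz.
have qE : q = (ord0 \in A, n ord0) by rewrite -zE ez.
have sz' : size z' = r by rewrite ez in sz; case: sz.
apply/andP/andP => [[/forallP Hp /forallP Hc]|[q0 /(pathP x0) Hp]].
  split; first by rewrite qE /= Hp.
  apply/(pathP x0) => i; rewrite sz' => ir.
  have ir1 : (i < r.+1)%N by apply: ltnW.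
  have := zE (Ordinal ir1); have := zE (@Ordinal r.+1 i.+1 ir).
  rewrite ez /= => -> ->; rewrite /zstep /=.
  have /forallP/(_ (@Ordinal r.+1 i.+1 ir)) := Hc (Ordinal ir1); rewrite /= eqxx /=.
  have := Hp (Ordinal ir1); case: (_ \in A) => /= ? ?; lia.
have H i j : val j = (val i).+1 -> (n i - (i \in A) < n j)%N.
  move=> ji; have ir : (i < size z')%N by rewrite sz'; move: (ltn_ord j); rewrite -[nat_of_ord j]/(val j) ji.
  by have := Hp i ir; rewrite -[nth x0 z' i]/(nth x0 (q :: z') i.+1) -ez -ji !zE.
(* Entries after the first are positive because each exceeds a natural number. *)
have Hpos i : (0 < n i)%N.
  case: (posnP (val i)) => [i0|i0].
    by move: q0; rewrite qE /= (_ : ord0 = i) //; apply: val_inj; rewrite /= i0.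
  have ir : ((val i).-1 < r.+1)%N by apply: leq_ltn_trans (leq_pred _) (ltn_ord i).
  by apply: leq_ltn_trans (H (Ordinal ir) i _) => //=; rewrite prednK.
split; first by apply/forallP.
apply/forallP => i; apply/forallP => j; apply/implyP => /eqP /H.
by have := Hpos i; case: (i \in A) => /= ? ?; lia.
Qed.

Lemma zprod k (A : {set 'I_(size k)}) (n : {ffun 'I_(size k) -> 'I_N}) :
  (\prod_(i in A) ((N - n i)%N%:R)^-1) * (\prod_(i in ~: A) ((n i)%:R ^- nth 0%N k i))
  = \prod_(x <- zip k (zip (bits A) [tuple n i | i < size k])) zfactor x.
Proof.
case: k A n => [|k1 k] A n; first by rewrite (size0nil (_ : size (zip _ _) = 0%N)) ?big_nil ?big1 ?mulr1 ?size_zip ?min0n // => -[].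
have i0 : 'I_(size (k1 :: k)) := ord0.
move: (k1 :: k) A n i0 => {k1}k A n i0; pose x0 := (0%N, (false, n i0)).
rewrite (big_nth x0) big_mkord.
set T := [tuple n i | i < size k].
have sz : size (zip (bits A) T) = size k by rewrite size_zip size_bits size_tuple minnn.
have zE (i : 'I_(size k)) : nth x0 (zip k (zip (bits A) T)) i = (nth 0%N k i, (i \in A, n i)).
  by rewrite /x0 nth_zip ?sz // nth_zip ?size_bits ?size_tuple // nth_bits -tnth_nth tnth_mktuple.
rewrite size_zip sz minnn [RHS](bigID (mem A)) /=; congr (_ * _).
  by apply: eq_bigr => i iA; rewrite zE /zfactor /= iA.
apply: eq_big => [i|i]; first by rewrite inE.
by rewrite inE => /negbTE iA; rewrite zE /zfactor /= iA.
Qed.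

Lemma zetad_zeta_tail k : zetad k N = zeta_tail N 0 k.
Proof.
rewrite -zsum_zeta_tail /zetad /zsum.
pose P (z : seq (bool * 'I_N)) := if z is q :: z' then (0 < q.2)%N && path zstep q z' else true.
pose G (s : seq bool) : rat := sumseq (size k) (fun n : seq 'I_N =>
   (P (zip s n))%:R * \prod_(x <- zip k (zip s n)) zfactor x).
transitivity (\sum_(A : {set 'I_(size k)} | A \subset [set i : 'I_(size k) | nth 0%N k i == 1%N]) G (bits A)).
  apply: eq_bigr => A _; rewrite /G -sum_ffun big_mkcond /=; apply: eq_bigr => n _.
  by rewrite zip_path -zprod /P; case: ifP => _; rewrite ?mul1r ?mul0r.
rewrite (@sum_setE _ _ (is1 k)) => [|A]; last exact: (subset_bits (pred1 1%N)).
apply: eq_sumseq => s _; rewrite -sumseqZ; apply: eq_sumseq => n _.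
by rewrite mulrA -natrM mulnb.
Qed.
End Zeta.

(** * Linear independence of truncated sums *)

(* The index is reversed: the first entry is the exponent of the largest variable. *)
Fixpoint harmonic (k : seq nat) (N : nat) : rat :=
  if k is j :: k' then \sum_(1 <= n < N) n%:R ^- j * harmonic k' n else 1.

Lemma harmonic_rec j k N : (0 < N)%N -> harmonic (j :: k) N.+1 = harmonic (j :: k) N + N%:R ^- j * harmonic k N.
Proof. by move=> N0; rewrite /= big_nat_recr. Qed.

Lemma harmonic1 j k : harmonic (j :: k) 1 = 0.
Proof. by rewrite /= big_geq. Qed.

Section Local.
Variables (q : nat) (q_pr : prime q).

(** The localization of the integers at q; [qsmall] is its maximal ideal. *)
Definition qint (x : rat) := exists (n : int) (d : nat), ~~ (q %| d)%N /\ x = n%:~R / d%:R.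
Definition qsmall (x : rat) := exists2 y, qint y & x = q%:R * y.

Lemma ndvd_neq0 d : ~~ (q %| d)%N -> d%:R != 0 :> rat.
Proof. by apply: contra; rewrite pnatr_eq0 => /eqP ->; rewrite dvdn0. Qed.

Lemma qint_int (n : int) : qint n%:~R.
Proof. by exists n, 1%N; rewrite dvdn1 divr1; split=> //; rewrite gtn_eqF ?prime_gt1. Qed.

Lemma qintD x y : qint x -> qint y -> qint (x + y).
Proof.
move=> [n [d [qd ->]]] [n' [d' [qd' ->]]].
exists (n * d' + n' * d), (d * d')%N; rewrite Euclid_dvdM // negb_or qd qd'; split=> //.
by rewrite natrM rmorphD !rmorphM /=; field; rewrite !ndvd_neq0.
Qed.

Lemma qintM x y : qint x -> qint y -> qint (x * y).
Proof.
move=> [n [d [qd ->]]] [n' [d' [qd' ->]]].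
exists (n * n'), (d * d')%N; rewrite Euclid_dvdM // negb_or qd qd'; split=> //.
by rewrite natrM rmorphM /=; field; rewrite !ndvd_neq0.
Qed.

Lemma qintX x n : qint x -> qint (x ^+ n).
Proof. by move=> qx; elim: n => [|n IH]; [exact: (qint_int 1) | rewrite exprS; exact: qintM]. Qed.

Lemma qintV d : ~~ (q %| d)%N -> qint d%:R^-1.
Proof. by move=> qd; exists 1, d; split=> //; rewrite mul1r. Qed.

Lemma qint_nat d : qint d%:R.
Proof. exact: (qint_int d). Qed.

Lemma qsmall0 : qsmall 0.
Proof. by exists 0; [exact: (qint_int 0) | rewrite mulr0]. Qed.

Lemma qsmallD x y : qsmall x -> qsmall y -> qsmall (x + y).
Proof. by move=> [u iu ->] [v iv ->]; exists (u + v); [exact: qintD | rewrite mulrDr]. Qed.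

Lemma qsmallMl x y : qint x -> qsmall y -> qsmall (x * y).
Proof. by move=> ix [v iv ->]; exists (x * v); [exact: qintM | rewrite mulrCA]. Qed.

Lemma qsmall_int x : qsmall x -> qint x.
Proof. by move=> [u iu ->]; apply: qintM => //; exact: qint_nat. Qed.

Lemma qsmall_sum (I : eqType) (r : seq I) (F : I -> rat) :
  (forall i, i \in r -> qsmall (F i)) -> qsmall (\sum_(i <- r) F i).
Proof.
elim: r => [|i r IH] H; first by rewrite big_nil; exact: qsmall0.
rewrite big_cons; apply: qsmallD; first by apply: H; rewrite inE eqxx.
by apply: IH => j jr; apply: H; rewrite inE jr orbT.
Qed.

Definition qcong x y := qsmall (x - y).

Lemma qcong_refl x : qcong x x.
Proof. by rewrite /qcong subrr; exact: qsmall0. Qed.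

Lemma qcongM x x' y y' : qint x -> qint y' -> qcong x x' -> qcong y y' -> qcong (x * y) (x' * y').
Proof.
move=> ix iy' cx cy; rewrite /qcong (_ : _ - _ = x * (y - y') + y' * (x - x')); last by ring.
by apply: qsmallD; exact: qsmallMl.
Qed.

Lemma qcong_int x y : qint y -> qcong x y -> qint x.
Proof. by move=> iy /qsmall_int ix; rewrite -(subrK y x); exact: qintD. Qed.

Lemma qcongX x y n : qint x -> qint y -> qcong x y -> qcong (x ^+ n) (y ^+ n).
Proof.
move=> ix iy c; elim: n => [|n IH]; first exact: qcong_refl.
by rewrite !exprS; apply: qcongM => //; exact: qintX.
Qed.

Lemma harmonic_qint k N : (N <= q)%N -> qint (harmonic k N).
Proof.
elim: k N => [|j k IH] N Nq; first exact: (qint_int 1).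
rewrite /= big_nat; elim/big_ind: _ => [|x y|n /andP[n0 nN]]; first exact: (qint_int 0).
  exact: qintD.
rewrite -exprVn; apply: qintM; last by apply: IH; lia.
by apply/qintX/qintV; rewrite gtnNdvd // (leq_trans nN).
Qed.

(* Modulo q, only the summation variables divisible by q contribute. *)
Lemma harmonic_scale k N : all (leq 1) k -> (0 < N <= q ^ 2)%N ->
  qcong (q%:R ^+ sumn k * harmonic k N) (harmonic k ((N.-1 %/ q).+1)).
Proof.
have q0 : (0 < q)%N by exact: prime_gt0.
have q0' : q%:R != 0 :> rat by rewrite pnatr_eq0 -lt0n.
elim: k N => [|j k IH] N; first by rewrite /= mul1r => *; exact: qcong_refl.
case/andP=> j0 k1; case: N => // N /=; elim: N => [|N IHN] Nq.
  by rewrite -!/(harmonic (_ :: _) _) div0n !harmonic1 mulr0; exact: qcong_refl.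
rewrite -!/(harmonic (_ :: _) _) in IHN *; rewrite harmonic_rec // mulrDr.
have {}IHN := IHN (ltnW Nq).
have {}IH : qcong (q%:R ^+ sumn k * harmonic k N.+1) (harmonic k (N %/ q).+1).
  by apply: (IH N.+1) => //=; exact: ltnW.
have iz : qint (harmonic k (N %/ q).+1).
  by apply: harmonic_qint; rewrite ltn_divLR //; move: Nq; rewrite expnS expn1; lia.
have -> : q%:R ^+ (j + sumn k) * (N.+1%:R ^- j * harmonic k N.+1) =
   (q%:R / N.+1%:R) ^+ j * (q%:R ^+ sumn k * harmonic k N.+1).
  by rewrite exprD expr_div_n; ring.
have congD x y z t : qcong x y -> qcong z t -> qcong (x + z) (y + t).
  by rewrite /qcong => c c'; rewrite (_ : _ - _ = x - y + (z - t)); [exact: qsmallD | ring].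
case: (boolP (q %| N.+1)%N) => [/dvdnP[m Nm]|qN].
  have m0 : (0 < m)%N by case: m Nm.
  (* The bound N <= q ^ 2 enters here: the variable q m has valuation exactly 1, and 1 / m is
     q-integral. *)
  have mq : (m < q)%N by move: Nq; rewrite Nm expnS expn1 ltn_pmul2r.
  have dN : (N.+1 %/ q = m)%N by rewrite Nm mulnK.
  have Nq1 : (N %/ q).+1 = m by rewrite -dN divnS // Nm dvdn_mull.
  rewrite Nq1 in IHN IH iz; rewrite dN (harmonic_rec _ _ m0); apply: congD; first exact: IHN.
  have -> : q%:R / N.+1%:R = m%:R^-1 :> rat.
    by rewrite Nm natrM invfM mulrCA mulfV // mulr1.
  rewrite exprVn; apply: qcongM => //; last exact: qcong_refl.
  by rewrite -exprVn; apply/qintX/qintV; rewrite gtnNdvd.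
have -> : (N.+1 %/ q = N %/ q)%N by rewrite divnS // (negbTE qN).
(* The new term carries (q / (N + 1))^j with N + 1 prime to q and j >= 1, hence is small. *)
rewrite -[X in qcong _ X]addr0; apply: congD => //.
rewrite /qcong subr0; clear IHN; case: j j0 => // j _; rewrite exprS mulrC [_ * (_ ^+ j)]mulrC mulrA.
apply: qsmallMl; last by exists (N.+1%:R^-1) => //; exact: qintV.
apply: qintM; first exact: qcong_int IH.
by apply/qintX/qintM; [exact: qint_nat | exact: qintV].
Qed.
End Local.

(** Some prime larger than the absolute value of the numerator divides it. *)
Lemma qsmall_all_eq0 (x : rat) :
  (forall B, exists q, [/\ prime q, (B < q)%N & qsmall q x]) -> x = 0.
Proof.
move=> H; have [q [q_pr qB [y [n [d [qd ->]]] xE]]] := H `|numq x|%N.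
have d0 := ndvd_neq0 qd.
have E : numq x * d%:Z = q%:Z * n * denq x.
  apply/eqP; rewrite -(eqr_int rat) !rmorphM /= -[x in numq x]/x.
  have := xE; rewrite -{1}[x]divq_num_den => /(congr1 (fun z => z * (denq x)%:~R * d%:R)).
  rewrite divfK ?intr_eq0 ?denq_eq0 // => ->; apply/eqP; field; exact: d0.
have : (q %| `|numq x| * d)%N.
  by have := congr1 absz E; rewrite !abszM /= => ->; rewrite -mulnA dvdn_mulr.
rewrite Euclid_dvdM // (negbTE qd) orbF => /dvdn_leq qx.
by apply/eqP; rewrite -numq_eq0 -absz_eq0; apply: contraLR qB; rewrite -lt0n -leqNgt.
Qed.

Lemma rat_qint q (x : rat) : prime q -> (`|denq x| < q)%N -> qint q x.
Proof.
move=> q_pr xq; exists (numq x), `|denq x|%N; split.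
  by rewrite gtnNdvd // absz_gt0 denq_neq0.
by rewrite [X in _ / X]pmulrn gez0_abs ?divq_num_den ?ltW ?denq_gt0.
Qed.

Lemma poly_inv_eq0 (p : {poly rat}) : (forall a, p.[a.+1%:R^-1] = 0) -> p = 0.
Proof.
move=> H; apply/eqP; apply: contraT => p0.
pose rs : seq rat := [seq a.+1%:R^-1 | a <- iota 0 (size p)].
have ars : all (root p) rs by apply/allP => x /mapP[a _ ->]; apply/rootP.
have urs : uniq rs.
  by rewrite map_inj_uniq ?iota_uniq // => a b /invr_inj /eqP; rewrite eqr_nat => /eqP[].
by have := max_poly_roots p0 ars urs; rewrite size_map size_iota ltnn.
Qed.

Lemma seq_argmax (T : eqType) (f : T -> nat) (s : seq T) x : x \in s ->
  exists2 y, y \in s & forall z, z \in s -> (f z <= f y)%N.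
Proof.
elim: s x => [//|a [|b s] IH] x _.
  by exists a; rewrite ?inE // => z; rewrite inE => /eqP ->.
have [y ys ymax] := IH b (mem_head _ _).
case: (leqP (f a) (f y)) => fay.
  by exists y => [|z]; rewrite inE ?ys ?orbT // => /orP[/eqP->|/ymax].
exists a => [|z]; rewrite inE ?eqxx // => /orP[/eqP->//|/ymax zy].
exact: leq_trans zy (ltnW fay).
Qed.

Lemma sum_lt_bounds B m a S q : (B + m + a + S + 2 < q)%N ->
  [/\ (B < q)%N, (m.+1 < q)%N, (a < q)%N & (S < q)%N].
Proof. by move=> h; split; lia. Qed.

Lemma quotient_succ m a q : (0 < a < q)%N -> ((m * q + a).-1 %/ q).+1 = m.+1.
Proof.
case/andP=> a0 aq; have q0 : (0 < q)%N by apply: leq_ltn_trans aq.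
by rewrite -subn1 -addnBA // divnMDl // divn_small ?addn0 // (leq_ltn_trans (leq_subr _ _)).
Qed.

Lemma mul_add_leq_sqr m a q : (m.+1 < q)%N -> (a < q)%N -> (m * q + a <= q ^ 2)%N.
Proof. by move=> mq aq; nia. Qed.

(* Difference the relation in N and take N = m q + a for a large prime q: modulo
   q, the terms whose tail has maximal weight give an exact relation with
   coefficients a^-j, valid for all a and m. It splits according to j, and each
   part is a relation of smaller depth. *)
Lemma harmonic_indep d (L : seq (seq nat)) (c : seq nat -> rat) :
  uniq L -> all (fun k => (size k <= d)%N && all (leq 1) k) L ->
  (forall N, (0 < N)%N -> \sum_(k <- L) c k * harmonic k N = 0) ->
  forall k, k \in L -> c k = 0.
Proof.
move=> uL /allP aL H k0 k0L.
suff noK k : k \in L -> k != [::] -> c k = 0.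
  case: (eqVneq k0 [::]) => [k00|]; last exact: noK.
  (* Only the empty index has a nonzero sum at N = 1, which isolates its coefficient. *)
  have := H 1%N isT; rewrite (bigD1_seq k0) //= k00 /= mulr1 big1_seq ?addr0 // => k.
  by case/andP=> kk kL; rewrite noK ?mul0r // -k00.
elim: d L c uL aL H {k0 k0L} k => [|d IH] L c uL aL H k kL kn0.
  by have := aL k kL; case: (k) kn0.
have {IH} IH L' c' : uniq L' -> (forall k, k \in L' -> (size k <= d)%N && all (leq 1) k) ->
    (forall N, (0 < N)%N -> \sum_(k <- L') c' k * harmonic k N = 0) ->
    forall k, k \in L' -> c' k = 0.
  move=> uL' aL' H' k' k'L.
  case: (eqVneq k' [::]) => [k0|]; last exact: IH H' k' k'L.
  have := H' 1%N isT; rewrite (bigD1_seq k') //= k0 /= mulr1 big1_seq ?addr0 // => k1.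
  by case/andP=> kk k1L; rewrite (IH L' c') ?mul0r // -k0.
apply/eqP; apply: contraT => ck0.
(* Zero coefficients are removed, so that deriving c k0 = 0 for a k0 of maximal tail weight is a
   contradiction. *)
pose K := [seq k <- L | (k != [::]) && (c k != 0)].
have kK : k \in K by rewrite mem_filter kn0 ck0.
have KP k' : k' \in K -> [/\ k' \in L, k' != [::] & all (leq 1) k'].
  by rewrite mem_filter => /andP[/andP[? _] k'L]; split=> //; case/andP: (aL _ k'L).
have Hd N : (0 < N)%N ->
  \sum_(k <- K) c k * N%:R ^- head 0%N k * harmonic (behead k) N = 0.
  move=> N0; have E1 := H N.+1 isT; have E0 := H N N0.
  transitivity (\sum_(k <- L) (c k * harmonic k N.+1 - c k * harmonic k N)); last by rewrite sumrB E1 E0 subrr.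
  rewrite big_filter big_mkcond /=; apply: eq_bigr => -[|j k'] _ /=; first by rewrite subrr.
  rewrite -!/(harmonic (_ :: _) _) harmonic_rec //; case: eqP => [->|_] /=; first by rewrite !mul0r subrr.
  ring.
pose wt (k : seq nat) := sumn (behead k).
have [k0 k0K wmax] : exists2 k0, k0 \in K & forall k', k' \in K -> (wt k' <= wt k0)%N.
  exact: seq_argmax kK.
pose w := wt k0.
have Ha m a : (0 < a)%N ->
    \sum_(k <- K | wt k == w) c k * a%:R ^- head 0%N k * harmonic (behead k) m.+1 = 0.
  move=> a0; apply: qsmall_all_eq0 => B.
  (* The prime q has to exceed B and the denominators of all coefficients, as well as a and m + 1,
     so that a and m q + a are units and m q + a <= q ^ 2. *)
  pose b := (B + m + a + \sum_(k <- K) `|denq (c k)| + 2)%N.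
  have [q bq q_pr] := prime_above b; exists q.
  have [qB qm qa' qS] := sum_lt_bounds bq.
  have N0 : (0 < m * q + a)%N by rewrite addn_gt0 a0 orbT.
  split=> //.
  set S := (X in qsmall _ X).
  (* Subtracting the differenced relation, scaled by q ^ w to make its heaviest tails integral,
     leaves a sum that is small term by term. *)
  have -> : S = S - q%:R ^+ w * \sum_(k <- K) c k * (m * q + a)%N%:R ^- head 0%N k
      * harmonic (behead k) (m * q + a) by rewrite Hd // mulr0 subr0.
  rewrite /S big_distrr [X in X - _]big_mkcond -sumrB /=; apply: qsmall_sum => // k' k'K.
  have [k'L k'n /allP k'1] := KP _ k'K.
  have ic : qint q (c k').
    apply: rat_qint => //; apply: leq_ltn_trans qS.
    by rewrite (bigD1_seq k') ?filter_uniq //= leq_addr.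
  have qa : ~~ (q %| a)%N by rewrite gtnNdvd.
  have qN : ~~ (q %| m * q + a)%N by rewrite dvdn_addr // dvdn_mull.
  have caN : qcong q a%:R^-1 (m * q + a)%N%:R^-1.
    exists (m%:R * (a%:R^-1 * (m * q + a)%N%:R^-1)).
      apply: qintM => //; first exact: qint_nat.
      by apply: qintM => //; exact: qintV.
    by have := ndvd_neq0 qN; have := ndvd_neq0 qa; rewrite natrD natrM => u0 v0; field; rewrite ?u0 ?v0.
  have cz : qcong q (q%:R ^+ wt k' * harmonic (behead k') (m * q + a)) (harmonic (behead k') m.+1).
    rewrite -(@quotient_succ m a q) ?a0 //; apply: harmonic_scale => //.
      by apply/allP => y /mem_behead /k'1.
    by rewrite N0 mul_add_leq_sqr.
  have iz : qint q (harmonic (behead k') m.+1) by apply: harmonic_qint => //; exact: ltnW.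
  have iN : qint q ((m * q + a)%N%:R^-1 ^+ head 0%N k') by apply/qintX/qintV.
  have ia : qint q (a%:R^-1 ^+ head 0%N k') by apply/qintX/qintV.
  rewrite -!exprVn; case: ifPn => [/eqP wk|wk].
    rewrite -wk (_ : _ * (_ * _ * _) = c k' * (m * q + a)%N%:R^-1 ^+ head 0%N k'
        * (q%:R ^+ wt k' * harmonic (behead k') (m * q + a))); last by ring.
    apply: qcongM => //; first exact: qintM.
    - exact: qcong_int cz.
    - apply: qcongM => //; first exact: qcong_refl.
      by apply: qcongX => //; exact: qintV.
    have [y iy E] := cz; exists (- y); last by rewrite mulrN -E opprB.
    by rewrite -mulN1r; apply: qintM => //; exact: (qint_int _ (-1)).
  (* A lighter tail leaves at least one spare factor q. *)
  have lw : (wt k' < w)%N by rewrite ltn_neqAle wk wmax.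
  rewrite sub0r -mulN1r; apply: qsmallMl => //; first exact: (qint_int _ (-1)).
  exists (q%:R ^+ (w - (wt k').+1) * (c k' * (m * q + a)%N%:R^-1 ^+ head 0%N k'
        * (q%:R ^+ wt k' * harmonic (behead k') (m * q + a)))).
    apply: qintM => //; first by apply: qintX => //; exact: qint_nat.
    by apply: qintM; [ | exact: qintM | exact: qcong_int cz].
  by rewrite -{1}(subnK lw) exprD exprS; ring.
(* For fixed m the relation [Ha] is a polynomial in 1 / a with infinitely many zeros. *)
have Hj j m : \sum_(k <- K | (wt k == w) && (head 0%N k == j)) c k * harmonic (behead k) m.+1 = 0.
  pose p : {poly rat} := \sum_(k <- K | wt k == w) (c k * harmonic (behead k) m.+1) *: 'X^(head 0%N k).
  have p0 : p = 0.
    apply: poly_inv_eq0 => a; rewrite horner_sum -[RHS](Ha m a.+1) //.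
    by apply: eq_bigr => k' _; rewrite hornerZ hornerXn exprVn; ring.
  have := congr1 (fun p : {poly rat} => p`_j) p0; rewrite coef0 coef_sum => E.
  rewrite -[RHS]E big_mkcondr /=; apply: eq_bigr => k' _.
  by rewrite coefZ coefXn eq_sym; case: eqP; rewrite ?mulr1 ?mulr0.
pose j0 := head 0%N k0.
pose L' := [seq behead k | k <- K & (wt k == w) && (head 0%N k == j0)].
(* With the first entry fixed, the tails are distinct and have depth at most d. *)
have : c (j0 :: behead k0) = 0.
  apply: (IH L' (fun k => c (j0 :: k))).
  - rewrite map_inj_in_uniq ?filter_uniq // => x y.
    rewrite !mem_filter => /andP[/andP[_ /eqP xj] /andP[/andP[xn _] _]].
    move=> /andP[/andP[_ /eqP yj] /andP[/andP[yn _] _]].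
    by case: x y xj xn yj yn => [|? ?] [|? ?] //= -> _ -> _ ->.
  - move=> k'; case/mapP=> x; rewrite mem_filter => /andP[_ /KP[xL xn xa]] ->.
    by have := aL x xL; case: (x) xn => //= ? ? _ /andP[s1 /andP[_ a1]]; apply/andP.
  - move=> [//|m] _; rewrite big_map big_filter -[RHS](Hj j0 m).
    rewrite big_seq_cond [RHS]big_seq_cond; apply: eq_bigr => x /andP[/KP[_ xn _] /andP[_ /eqP xj]].
    by case: x xn xj => //= ? ? _ ->.
  apply/mapP; exists k0 => //; by rewrite mem_filter !eqxx.
have [_ k0n _] := KP _ k0K; move: k0K; rewrite mem_filter /j0.
by case: (k0) k0n => //= ? ? _ /andP[+ _] c0; rewrite c0 eqxx.
Qed.

(** * Words in the free algebra *)

Definition wordU (s : seq bool) : H := mkmalgU (FMonom s) 1.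

Lemma wordU_nil : wordU [::] = 1.
Proof. by rewrite /wordU -fmoneE. Qed.

Lemma wordU_cat s r : wordU s * wordU r = wordU (s ++ r).
Proof. by rewrite /wordU malgM_def fgmulUU mulr1; congr (mkmalgU _ _); exact: fmmulE. Qed.

Lemma xHE : xH = wordU [:: false].
Proof. by rewrite /xH /letter fmuE. Qed.

Lemma yHE : yH = wordU [:: true].
Proof. by rewrite /yH /letter fmuE. Qed.

Lemma xHX n : xH ^+ n = wordU (nseq n false).
Proof. by elim: n => [|n IH]; rewrite ?expr0 ?wordU_nil // exprS IH xHE wordU_cat. Qed.

Lemma H_expand (p : H) : p = \sum_(m <- msupp p) p@_m *: wordU (fmonom_val m).
Proof.
rewrite {1}[p]monalgE; apply: eq_bigr => m _; apply/malgP => k.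
by rewrite mcoeffZ !mcoeffU -[LHS]mulr_natr; congr (_ * (_ == _)%:R); rewrite fmK.
Qed.

Section Ext.
Variables (V : lmodType rat) (phi : seq bool -> V).
Definition linext (p : H) : V := \sum_(m <- msupp p) p@_m *: phi (fmonom_val m).

Lemma linextEw (d : {fset {fmonom bool}}) p : (msupp p `<=` d)%fset ->
  linext p = \sum_(m <- d) p@_m *: phi (fmonom_val m).
Proof.
move=> le; rewrite /linext (big_fset_incl _ le) // => m _ /mcoeff_outdom ->.
by rewrite scale0r.
Qed.

Lemma linext_lin a p q : linext (a *: p + q) = a *: linext p + linext q.
Proof.
pose d := (msupp p `|` msupp q)%fset.
have lp : (msupp p `<=` d)%fset by exact: fsubsetUl.
have lq : (msupp q `<=` d)%fset by exact: fsubsetUr.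
have lpq : (msupp (a *: p + q) `<=` d)%fset.
  by apply: fsubset_trans (msuppD_le _ _) _; apply: fsetSU; exact: msuppZ_le.
rewrite (linextEw lp) (linextEw lq) (linextEw lpq) scaler_sumr -big_split /=.
by apply: eq_bigr => m _; rewrite mcoeffD mcoeffZ scalerDl scalerA.
Qed.

Lemma linext0 : linext 0 = 0.
Proof. by rewrite /linext msupp0 big_seq_fset0. Qed.

Lemma linextD p q : linext (p + q) = linext p + linext q.
Proof. by rewrite -[p in LHS]scale1r linext_lin scale1r. Qed.

Lemma linextZ a p : linext (a *: p) = a *: linext p.
Proof. by rewrite -[a *: p]addr0 linext_lin linext0 addr0. Qed.

Lemma linextU s : linext (wordU s) = phi s.
Proof.
by rewrite /linext /wordU msuppU oner_eq0 big_seq_fset1 mcoeffU eqxx scale1r.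
Qed.

Lemma linext_sum (I : Type) (r : seq I) (P : pred I) (F : I -> H) :
  linext (\sum_(i <- r | P i) F i) = \sum_(i <- r | P i) linext (F i).
Proof. exact: (big_morph linext linextD linext0). Qed.
End Ext.

Definition zeta_lin N : H -> rat^o := linext (fun s => zeta_word s N : rat^o).

Lemma ZdE p N : Zd p N = zeta_lin N p.
Proof. by []. Qed.

Lemma DmapE p : Dmap p = linext D_word p.
Proof. by []. Qed.

Section Supp.
Definition supp (P : seq bool -> Prop) (p : H) := forall m, m \in msupp p -> P (fmonom_val m).

Variable P : seq bool -> Prop.

Lemma supp0 : supp P 0.
Proof. by move=> m; rewrite msupp0. Qed.

Lemma suppD p q : supp P p -> supp P q -> supp P (p + q).
Proof.
by move=> Pp Pq m /(fsubsetP (msuppD_le _ _)); rewrite in_fsetU => /orP[/Pp|/Pq].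
Qed.

Lemma suppZ a p : supp P p -> supp P (a *: p).
Proof. by move=> Pp m /(fsubsetP (msuppZ_le _ _)) /Pp. Qed.

Lemma supp_wordU s : P s -> supp P (wordU s).
Proof. by move=> Ps m; rewrite /wordU msuppU oner_eq0 in_fset1 => /eqP ->. Qed.

Lemma supp_sum (I : eqType) (r : seq I) (Q : pred I) (F : I -> H) :
  (forall i, i \in r -> Q i -> supp P (F i)) -> supp P (\sum_(i <- r | Q i) F i).
Proof.
move=> H; rewrite big_seq_cond; elim/big_ind: _ => [|p q|i /andP[]]; [exact: supp0|exact: suppD|exact: H].
Qed.
End Supp.

Lemma supp_mul_wordU (P Q : seq bool -> Prop) p r : supp P p -> (forall s, P s -> Q (s ++ r)) ->
  supp Q (p * wordU r).
Proof.
move=> Pp PQ; rewrite [p]H_expand mulr_suml; apply: supp_sum => m mp _.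
rewrite -scalerAl wordU_cat; apply: suppZ; apply: supp_wordU; apply: PQ; exact: Pp.
Qed.

Fixpoint index_word (k : seq nat) : seq bool :=
  if k is x :: k' then true :: nseq x.-1 false ++ index_word k' else [::].

Definition ge2word s := exists2 k, all (leq 2) k & s = index_word k.
(** Excluding the empty word makes the set stable under appending powers of x. *)
Definition ge2word1 s := exists2 k, all (leq 2) k /\ k != [::] & s = index_word k.

Lemma index_word_rcons k x : index_word (rcons k x) = index_word k ++ true :: nseq x.-1 false.
Proof. by elim: k => [|y k IH] /=; rewrite ?cats0 // IH catA. Qed.

Lemma idx_aux_nseq m k : all (leq 1) k -> idx_aux (nseq m false ++ index_word k) = m.+1 :: k.
Proof.
move=> k1; elim: m => [|m IH]; last by rewrite /= IH.
elim: k k1 => [//|x k IH] /= /andP[x1 k1].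
congr (_ :: _); have {}IH := IH k1; rewrite -[in RHS](prednK x1).
elim: (x.-1) => [|n IHn] /=; first exact: IH.
by rewrite IHn.
Qed.

Lemma zeta_index_word k N : all (leq 1) k -> zeta_word (index_word k) N = zeta_tail N 0 k.
Proof.
case: k => [//|x k] /= /andP[x1 k1].
by rewrite idx_aux_nseq // prednK // zetad_zeta_tail.
Qed.

(** Without entries 1 the set A is empty and N enters only as the upper bound, so the new terms are
    those whose last variable is N. *)
Lemma zeta_tail_rcons N a k x : all (leq 2) (rcons k x) -> (a < N)%N ->
  zeta_tail N.+1 a (rcons k x) = zeta_tail N a (rcons k x) + N%:R ^- x * zeta_tail N a k.
Proof.
elim: k a => [|y k IH] a /=.
  rewrite andbT => x2 aN; rewrite big_nat_recr //=.
  have -> : (x == 1)%N = false by case: x x2 => [|[]].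
  rewrite [X in _ + (_ + X)]mul0r addr0; congr (_ + _).
  by apply: eq_bigr => i _; rewrite !mul0r.
case/andP=> y2 k2 aN; rewrite big_nat_recr //=.
have y1 : (y == 1)%N = false by case: y y2 => [|[]].
have z : zeta_tail N.+1 N (rcons k x) = 0 by case: (k) => [|? ?]; rewrite /= big_geq.
rewrite y1 z mulr0 mul0r !addr0 big_distrr -big_split /=.
apply: eq_big_nat => n /andP[an nN]; rewrite IH // !mul0r !addr0; ring.
Qed.

Lemma all_ge21 k : all (leq 2) k -> all (leq 1) k.
Proof. by apply: sub_all => x; apply: leq_trans. Qed.

Lemma zeta_tail_harmonic k N : all (leq 2) k -> (0 < N)%N -> zeta_tail N 0 k = harmonic (rev k) N.
Proof.
elim/last_ind: k N => [//|k x IH] N k2; rewrite rev_rcons; elim: N => [//|N IHN] _.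
case: (posnP N) => [->|N0]; first by rewrite harmonic1; case: (k) => [|? ?]; rewrite /= big_geq.
rewrite zeta_tail_rcons // harmonic_rec // IHN // IH //.
by move: k2; rewrite all_rcons => /andP[].
Qed.

Lemma zeta_lin_mul N (p : H) s :
  zeta_lin N (p * wordU s) = \sum_(m <- msupp p) p@_m * zeta_word (fmonom_val m ++ s) N.
Proof.
rewrite {1}[p]H_expand mulr_suml /zeta_lin linext_sum; apply: eq_bigr => m _.
by rewrite -scalerAl wordU_cat linextZ linextU.
Qed.

Lemma zeta_linE N (p : H) : zeta_lin N p = \sum_(m <- msupp p) p@_m * zeta_word (fmonom_val m) N.
Proof. by []. Qed.

Lemma index_word_nseq k x n : (0 < x)%N -> index_word (rcons k x) ++ nseq n false = index_word (rcons k (x + n)).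
Proof.
by case: x => // x _; rewrite !index_word_rcons -catA /= -nseqD.
Qed.

(** Appending x^n raises the last exponent by n, and in the difference the last variable is N. *)
Lemma zeta_delta_x k n N : all (leq 2) k -> k != [::] -> (0 < N)%N ->
  zeta_word (index_word k ++ nseq n false) N.+1 - zeta_word (index_word k ++ nseq n false) N
  = N%:R ^- n * (zeta_word (index_word k) N.+1 - zeta_word (index_word k) N).
Proof.
case/lastP: k => // k x k2 _ N0; have x2 : (2 <= x)%N by move: k2; rewrite all_rcons => /andP[].
have kn2 : all (leq 2) (rcons k (x + n)).
  by move: k2; rewrite !all_rcons => /andP[_ ->]; rewrite andbT; lia.
rewrite index_word_nseq ?(ltnW x2) // !zeta_index_word ?all_ge21 // !zeta_tail_rcons // !(addrC (zeta_tail N 0 (rcons _ _))) !addrK.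
by rewrite exprD invfM mulrA [_^-1 * _^-1]mulrC.
Qed.

(** The appended letters form a new last entry n + 1 >= 2, whose variable is N in the difference. *)
Lemma zeta_delta_yx k n N : all (leq 2) k -> (0 < n)%N -> (0 < N)%N ->
  zeta_word (index_word k ++ true :: nseq n false) N.+1 - zeta_word (index_word k ++ true :: nseq n false) N
  = N%:R ^- n.+1 * zeta_word (index_word k) N.
Proof.
move=> k2 n0 N0; rewrite -(index_word_rcons k n.+1).
have kn2 : all (leq 2) (rcons k n.+1) by rewrite all_rcons k2 andbT.
by rewrite !zeta_index_word ?all_ge21 // zeta_tail_rcons // addrC addKr.
Qed.

Lemma zeta_lin_delta_x (p : H) n N : supp ge2word1 p -> (0 < N)%N ->
  zeta_lin N.+1 (p * xH ^+ n) - zeta_lin N (p * xH ^+ n) = N%:R ^- n * (zeta_lin N.+1 p - zeta_lin N p).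
Proof.
move=> pP N0; rewrite xHX !zeta_lin_mul !zeta_linE -!sumrB big_distrr /=.
rewrite [LHS]big_seq_cond [RHS]big_seq_cond; apply: eq_bigr => m /andP[/pP[k [k2 kn] ->] _].
by rewrite -mulrBr zeta_delta_x // -mulrBr mulrCA.
Qed.

Lemma zeta_lin_delta_yx (p : H) n N : supp ge2word p -> (0 < n)%N -> (0 < N)%N ->
  zeta_lin N.+1 (p * (yH * xH ^+ n)) - zeta_lin N (p * (yH * xH ^+ n)) = N%:R ^- n.+1 * zeta_lin N p.
Proof.
move=> pP n0 N0; rewrite xHX yHE wordU_cat /= !zeta_lin_mul !zeta_linE -!sumrB big_distrr /=.
rewrite [LHS]big_seq_cond [RHS]big_seq_cond; apply: eq_bigr => m /andP[/pP[k k2 ->] _].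
by rewrite -mulrBr zeta_delta_yx // mulrCA.
Qed.

Lemma zeta_lin1_eq0 (p : H) : supp ge2word1 p -> zeta_lin 1 p = 0.
Proof.
move=> pP; rewrite zeta_linE big_seq_cond big1 // => m /andP[/pP[k [k2 kn] ->] _].
by rewrite zeta_index_word ?all_ge21 //; case: k k2 kn => // x k _ _; rewrite zeta_tail0 ?mulr0.
Qed.

Lemma supp_mulx (p : H) n : supp ge2word1 p -> supp ge2word1 (p * xH ^+ n).
Proof.
move=> pP; rewrite xHX; apply: supp_mul_wordU pP _ => s [k [k2 kn] ->].
case/lastP: k kn k2 => // k x _; rewrite all_rcons => /andP[x2 k2].
rewrite index_word_nseq ?(ltnW x2) //; exists (rcons k (x + n)) => //; split.
  by rewrite all_rcons k2 andbT; lia.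
by case: (k).
Qed.

Lemma supp_mulyx (p : H) n : (0 < n)%N -> supp ge2word p -> supp ge2word1 (p * (yH * xH ^+ n)).
Proof.
move=> n0 pP; rewrite xHX yHE wordU_cat /=; apply: supp_mul_wordU pP _ => s [k k2 ->].
exists (rcons k n.+1); last by rewrite index_word_rcons.
by split; [rewrite all_rcons k2 andbT | case: (k)].
Qed.

Lemma dropseq_pos c s r : all (leq 1) c -> isbig c r -> all (leq 1) (dropseq c s r).
Proof.
elim: c s r => [|x c IH] [|a s] [|b r] //= /andP[x1 c1] /andP[bx cr].
case: a; first exact: IH.
by rewrite /= IH // andbT subn_gt0; case: b bx => //=; lia.
Qed.

Lemma dropseq_sumn c s r : is1 c s -> isbig c r -> all (leq 1) c ->
  (sumn (dropseq c s r) + (count id s + count id r) = sumn c)%N.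
Proof.
elim: c s r => [|x c IH] [|a s] [|b r] //= /andP[ax cs] /andP[bx cr] /andP[x1 c1].
have := IH _ _ cs cr c1; case: a ax => /= ax; case: b bx => /= bx; lia.
Qed.

Lemma dropseq_size c s r : size s = size c -> size r = size c ->
  (size (dropseq c s r) + count id s = size c)%N.
Proof.
elim: c s r => [|x c IH] [|a s] [|b r] //= [ss] [sr].
by have := IH _ _ ss sr; case: a => /=; lia.
Qed.

Lemma paired_even s : paired s -> ~~ odd (count id s).
Proof.
elim/list2_ind: s => [//|a|a b s IH] /=; first by move=> /negbTE ->.
by case/andP => /eqP <- /IH; rewrite addnA addnn oddD odd_double.
Qed.

Lemma odd_even_neq1 n (A : {set 'I_n}) : odd_even A -> #|A| != 1%N.
Proof. by rewrite odd_even_bits -count_bits => /paired_even; apply: contra => /eqP ->. Qed.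

Lemma even_odd_neq1 n (A : {set 'I_n.+1}) : even_odd A -> #|A| != 1%N.
Proof.
rewrite even_odd_bits -count_bits => /andP[]; case: (bits A) => [//|a s] /= /negbTE -> /paired_even.
by rewrite add0n; apply: contra => /eqP ->.
Qed.

Lemma noEO_card1 n (B : {set 'I_n}) : #|B| = 1%N -> noEO B && noOE B.
Proof.
move=> /eqP/cards1P[i0 ->]; apply/andP; split; apply/forall_inP => i; rewrite inE => /eqP ->;
  apply/implyP => _; apply/existsP => -[j /andP[]]; rewrite inE /pos /= => + /eqP ji;
  by rewrite ji eqn_leq ltnn andbF.
Qed.

Lemma even_odd0 n : @even_odd n set0 && @odd_even n set0.
Proof. by apply/andP; split; apply/forall_inP => i; rewrite inE. Qed.

Lemma noEO0 n : @noEO n set0 && @noOE n set0.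
Proof. by apply/andP; split; apply/forall_inP => i; rewrite inE. Qed.

Section Drop.
Variable b : seq nat.
Let c := map succn b.
Let ones := [set i : 'I_(size c) | nth 0%N c i == 1%N].
Let bigs := [set i : 'I_(size c) | (1 < nth 0%N c i)%N].
Variables A B : {set 'I_(size c)}.
Hypotheses (A1 : A \subset ones) (B1 : B \subset bigs).

Lemma cdrop_succn : map succn (map predn (cdrop A B)) = cdrop A B.
Proof.
have : all (leq 1) (cdrop A B).
  rewrite cdrop_bits; apply: dropseq_pos; first by rewrite /c; apply/allP => x /mapP[y _ ->].
  by rewrite /isbig -(subset_bits (fun x => 1 < x)%N).
by elim: (cdrop A B) => [//|x s IH] /= /andP[x1 s1]; rewrite IH // prednK.
Qed.

Lemma cdrop_sumn : (sumn (cdrop A B) + (#|A| + #|B|) = sumn c)%N.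
Proof.
rewrite cdrop_bits -!count_bits; apply: dropseq_sumn.
- by rewrite /is1 -(subset_bits (pred1 1%N)).
- by rewrite /isbig -(subset_bits (fun x => 1 < x)%N).
by rewrite /c; apply/allP => x /mapP[y _ ->].
Qed.

Lemma cdrop_size : (size (cdrop A B) + #|A| = size b)%N.
Proof. by rewrite cdrop_bits -count_bits dropseq_size ?size_bits // size_map. Qed.
End Drop.

(** * Invariance of zeta^diamond under D *)

Lemma even_odd_bits_gt0 n (A : {set 'I_n}) : (0 < n)%N ->
  even_odd A = ~~ head false (bits A) && paired (behead (bits A)).
Proof. by case: n A => // n A _; exact: even_odd_bits. Qed.

Lemma even_odd_neq1_gt0 n (A : {set 'I_n}) : (0 < n)%N -> even_odd A -> #|A| != 1%N.
Proof. by case: n A => // n A _; exact: even_odd_neq1. Qed.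

Lemma odd_even_card n (A : {set 'I_n}) : odd_even A -> ~~ odd #|A|.
Proof. by rewrite odd_even_bits -count_bits => /paired_even. Qed.

Lemma even_odd_card n (A : {set 'I_n}) : (0 < n)%N -> even_odd A -> ~~ odd #|A|.
Proof.
move=> n0; rewrite even_odd_bits_gt0 // -count_bits; case: (bits A) => [//|a s] /= /andP[/negbTE -> /paired_even].
by rewrite add0n.
Qed.

(** Position 1 is never in an even-odd A, so the remaining list is nonempty and its image under D
    may be multiplied by a power of x alone. *)
Lemma even_odd_lt n (A : {set 'I_n}) : (0 < n)%N -> even_odd A -> (#|A| < n)%N.
Proof.
move=> n0; rewrite even_odd_bits_gt0 // -count_bits; have := size_bits A.
case: (bits A) => [/= n1|a s /= <- /andP[/negbTE -> _]]; first by rewrite -n1 in n0.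
by rewrite add0n ltnS count_size.
Qed.

Section DoubleSums.
Variable c : seq nat.
Local Notation T := {set 'I_(size c)}.
Let ones := [set i : 'I_(size c) | nth 0%N c i == 1%N].
Let bigs := [set i : 'I_(size c) | (1 < nth 0%N c i)%N].

Definition eo_admissible m (A B : T) := [&& A \subset ones, even_odd A, B \subset bigs, (m <= #|A| + #|B|)%N & noEO B].
Definition oe_admissible m (A B : T) := [&& A \subset ones, odd_even A, B \subset bigs, (m <= #|A| + #|B|)%N & noOE B].

Definition double_sum (P : T -> T -> bool) (F : T -> T -> rat) : rat :=
  \sum_(A : T) \sum_(B : T) (P A B)%:R * F A B.

Lemma double_sumE (P : pred T) (Q : T -> pred T) F :
  \sum_(A : T | P A) \sum_(B : T | Q A B) F A B = double_sum (fun A B => P A && Q A B) F.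
Proof.
rewrite big_mkcond /=; apply: eq_bigr => A _; case: (P A) => /=.
  by rewrite big_mkcond /=; apply: eq_bigr => B _; case: (Q A B); rewrite ?mul1r ?mul0r.
by rewrite big1 // => B _; rewrite mul0r.
Qed.

Definition set_weight (t : rat) (f : seq nat -> rat) (A B : T) : rat :=
  (-1) ^+ #|B| * (t ^+ (#|A| + #|B|) * f (cdrop A B)).

Lemma eq_double_sum (P P' : T -> T -> bool) (F G : T -> T -> rat) : (forall A B, P A B = P' A B) ->
  (forall A B, P A B -> F A B = G A B) -> double_sum P F = double_sum P' G.
Proof.
move=> eP eF; apply: eq_bigr => A _; apply: eq_bigr => B _; rewrite -eP.
by case E: (P A B); rewrite ?mul0r // eF.
Qed.

Lemma double_sumB (P : T -> T -> bool) (F G : T -> T -> rat) : double_sum P F - double_sum P G = double_sum P (fun A B => F A B - G A B).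
Proof.
rewrite /double_sum -sumrB; apply: eq_bigr => A _; rewrite -sumrB; apply: eq_bigr => B _.
by rewrite mulrBr.
Qed.

Lemma double_sumN (P : T -> T -> bool) (F : T -> T -> rat) : - double_sum P F = double_sum P (fun A B => - F A B).
Proof.
rewrite /double_sum -sumrN; apply: eq_bigr => A _; rewrite -sumrN; apply: eq_bigr => B _.
by rewrite mulrN.
Qed.

Lemma double_sum_osum t f : double_sum (oe_admissible 0) (set_weight t f) = osum t f c.
Proof.
rewrite /osum /double_sum.
transitivity (\sum_(A : T) (fun s : seq bool => sumseq (size c) (fun r =>
  [&& is1 c s, paired s, isbig c r & unpaired r]%:R * bit_weight t f c s r)) (bits A)).
  apply: eq_bigr => A _ /=; rewrite -sum_set; apply: eq_bigr => B _.
  rewrite /oe_admissible /is1 /isbig -(subset_bits (pred1 1%N)) -(subset_bits (fun x => 1 < x)%N).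
  by rewrite odd_even_bits noOE_bits /bit_weight /set_weight !count_bits cdrop_bits.
exact: sum_set.
Qed.

Lemma double_sum_esum t f : c != [::] -> double_sum (eo_admissible 0) (set_weight t f) = esum t f c.
Proof.
move=> c0; rewrite /esum /double_sum.
transitivity (\sum_(A : T) (fun s : seq bool => sumseq (size c) (fun r =>
  [&& is1 c s, ~~ head false s && paired (behead s), isbig c r & unpaired (behead r)]%:R
    * bit_weight t f c s r)) (bits A)).
  apply: eq_bigr => A _ /=; rewrite -sum_set; apply: eq_bigr => B _.
  rewrite /eo_admissible /is1 /isbig -(subset_bits (pred1 1%N)) -(subset_bits (fun x => 1 < x)%N).
  rewrite even_odd_bits_gt0 ?lt0n ?size_eq0 //.
  by rewrite noEO_bits /bit_weight /set_weight !count_bits cdrop_bits.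
exact: sum_set.
Qed.

Lemma double_sum_set0 F : F set0 set0 = double_sum (fun A B => (A == set0) && (B == set0)) F.
Proof.
rewrite /double_sum (bigD1 set0) //= (bigD1 set0) //= !eqxx mul1r.
rewrite big1 => [|B /negbTE ->]; last by rewrite mul0r.
by rewrite big1 ?addr0 // => A /negbTE A0; rewrite big1 // => B _; rewrite A0 mul0r.
Qed.

Lemma eo_sum_split0 F : double_sum (eo_admissible 0) F = double_sum (eo_admissible 1) F + F set0 set0.
Proof.
rewrite (double_sum_set0 F) /double_sum -big_split; apply: eq_bigr => A _; rewrite -big_split /=.
apply: eq_bigr => B _; rewrite -mulrDl; congr (_ * _); rewrite /eo_admissible.
case: (eqVneq A set0) => [->|A0].
  case: (eqVneq B set0) => [->|B0].
    by have /andP[e1 e2] := even_odd0 (size c); have /andP[e3 e4] := noEO0 (size c);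
      rewrite ?e1 ?e2 ?e3 ?e4 !sub0set cards0 /= add0r.
  by rewrite addr0 (_ : (0 < _)%N) // cards0 add0n card_gt0.
by rewrite addr0 (_ : (0 < _)%N) // addn_gt0 card_gt0 A0.
Qed.

Lemma oe_sum_split0 F : double_sum (oe_admissible 0) F = double_sum (oe_admissible 1) F + F set0 set0.
Proof.
rewrite (double_sum_set0 F) /double_sum -big_split; apply: eq_bigr => A _; rewrite -big_split /=.
apply: eq_bigr => B _; rewrite -mulrDl; congr (_ * _); rewrite /oe_admissible.
case: (eqVneq A set0) => [->|A0].
  case: (eqVneq B set0) => [->|B0].
    by have /andP[e1 e2] := even_odd0 (size c); have /andP[e3 e4] := noEO0 (size c);
      rewrite ?e1 ?e2 ?e3 ?e4 !sub0set cards0 /= add0r.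
  by rewrite addr0 (_ : (0 < _)%N) // cards0 add0n card_gt0.
by rewrite addr0 (_ : (0 < _)%N) // addn_gt0 card_gt0 A0.
Qed.

(** A is a union of pairs, so total weight one means that A is empty and B a singleton, and such a
    pair is admissible for both kinds. *)
Lemma eo_oe_sum1 F : c != [::] ->
  double_sum (eo_admissible 1) F - double_sum (eo_admissible 2) F = double_sum (oe_admissible 1) F - double_sum (oe_admissible 2) F.
Proof.
move=> c0; rewrite /double_sum -!sumrB; apply: eq_bigr => A _; rewrite -!sumrB; apply: eq_bigr => B _.
rewrite -!mulrBl; congr (_ * _).
suff E : eo_admissible 1 A B && (#|A| + #|B| == 1)%N = oe_admissible 1 A B && (#|A| + #|B| == 1)%N.
  have split1 (x y z u : bool) n : ([&& x, y, z, (1 <= n)%N & u]%:R - [&& x, y, z, (2 <= n)%N & u]%:R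
     = ([&& x, y, z, (1 <= n)%N & u] && (n == 1%N))%:R :> rat).
    by case: x; case: y; case: z; case: u; case: n => [|[|n]]; rewrite /= ?andbF ?subrr ?subr0.
  by rewrite !split1 -/(eo_admissible 1 A B) -/(oe_admissible 1 A B) E.
case: eqP => [AB1|]; last by rewrite !andbF.
have eA : even_odd A -> #|A| != 1%N by apply: even_odd_neq1_gt0; rewrite lt0n size_eq0.
have A01 : #|A| = 0%N \/ #|A| = 1%N by lia.
rewrite !andbT /eo_admissible /oe_admissible; case: A01 => [A0|A1].
  have B1 : #|B| = 1%N by lia.
  have /andP[-> ->] := noEO_card1 B1.
  by have /eqP := A0; rewrite cards_eq0 => /eqP ->; have /andP[-> ->] := even_odd0 (size c).
have -> : even_odd A = false by apply/negP => /eA; rewrite A1.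
by have -> : odd_even A = false by apply/negP => /odd_even_neq1; rewrite A1.
Qed.

End DoubleSums.

Lemma Dfrak_fuelE fuel c : c != [::] ->
  let ones := [set i : 'I_(size c) | nth 0%N c i == 1%N] in
  let bigs := [set i : 'I_(size c) | (1 < nth 0%N c i)%N] in
  Dfrak_fuel fuel.+1 c =
  (\sum_(A : {set 'I_(size c)} | (A \subset ones) && even_odd A)
      \sum_(B : {set 'I_(size c)} | [&& B \subset bigs, (1 <= #|A| + #|B|)%N & noEO B])
        (-1) ^+ (#|B|.+1) *: (Dfrak_fuel fuel (cdrop A B) * xH ^+ (#|A| + #|B|)))
    + (\sum_(A : {set 'I_(size c)} | (A \subset ones) && even_odd A)
      \sum_(B : {set 'I_(size c)} | [&& B \subset bigs, (2 <= #|A| + #|B|)%N & noEO B])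
        (-1) ^+ (#|B|.+1) *: (Dfrak_fuel fuel (cdrop A B) * (yH * xH ^+ (#|A| + #|B|).-1)))
    + (\sum_(A : {set 'I_(size c)} | (A \subset ones) && odd_even A)
      \sum_(B : {set 'I_(size c)} | [&& B \subset bigs, (2 <= #|A| + #|B|)%N & noOE B])
        (-1) ^+ #|B| *: (Dfrak_fuel fuel (cdrop A B) * (yH * xH ^+ (#|A| + #|B|).-1))).
Proof. by case: c. Qed.

Lemma supp_ge2word p : supp ge2word1 p -> supp ge2word p.
Proof. by move=> pP m /pP[k [k2 _] ->]; exists k. Qed.

Lemma zeta_linD N p q : zeta_lin N (p + q) = zeta_lin N p + zeta_lin N q.
Proof. exact: linextD. Qed.

Lemma zeta_linB N p q : zeta_lin N (p - q) = zeta_lin N p - zeta_lin N q.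
Proof. by rewrite /zeta_lin linextD -scaleN1r linextZ scaleN1r. Qed.

Lemma zeta_lin_delta3 N p q r : zeta_lin N.+1 (p + q + r) - zeta_lin N (p + q + r)
  = (zeta_lin N.+1 p - zeta_lin N p) + (zeta_lin N.+1 q - zeta_lin N q) + (zeta_lin N.+1 r - zeta_lin N r).
Proof. by rewrite /zeta_lin !linextD; ring. Qed.

Lemma zeta_lin_delta_sum N (I J : finType) (P : pred I) (Q : I -> pred J) (a : I -> J -> rat) (g : I -> J -> H) :
  zeta_lin N.+1 (\sum_(i | P i) \sum_(j | Q i j) a i j *: g i j)
  - zeta_lin N (\sum_(i | P i) \sum_(j | Q i j) a i j *: g i j)
  = \sum_(i | P i) \sum_(j | Q i j) a i j * (zeta_lin N.+1 (g i j) - zeta_lin N (g i j)).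
Proof.
rewrite /= /zeta_lin !linext_sum -sumrB; apply: eq_bigr => i _; rewrite !linext_sum -sumrB.
by apply: eq_bigr => j _; rewrite !linextZ -mulrBr.
Qed.

Lemma eq_reduce_tail t f g b : f =1 g -> reduce_tail t f b = reduce_tail t g b.
Proof.
move=> e; case: b => [|i r] /=; first exact: e.
by apply: eq_reduce => s; rewrite e; congr (_ - _ * _); apply: eq_shift => i'.
Qed.

(** The supports belong to the induction because the differences of products with x^n and y x^n are
    computed only on words with all exponents at least 2. For nonempty b the values follow by
    summing the differences from N = 1, where both sides vanish. *)
Lemma Dfrak_fuel_spec fuel b : ~~ odd (size b) -> (sumn (map succn b) <= fuel)%N ->
  [/\ supp ge2word (Dfrak_fuel fuel (map succn b)),
      b != [::] -> supp ge2word1 (Dfrak_fuel fuel (map succn b))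
    & forall N, (0 < N)%N -> zeta_lin N (Dfrak_fuel fuel (map succn b)) = block_tail N 0 b].
Proof.
elim: fuel b => [|fuel IH] b sb bf.
  case: b sb bf => [_ _|//]; split=> //=; first by rewrite -wordU_nil; apply: supp_wordU; exists [::].
  by move=> N _; rewrite -wordU_nil /zeta_lin linextU.
case: (eqVneq b [::]) => [->|b0].
  split=> //=; first by rewrite -wordU_nil; apply: supp_wordU; exists [::].
  by move=> N _; rewrite -wordU_nil /zeta_lin linextU.
set c := map succn b.
have IHc (A B : {set 'I_(size c)}) :
    A \subset [set i : 'I_(size c) | nth 0%N c i == 1%N] ->
    B \subset [set i : 'I_(size c) | (1 < nth 0%N c i)%N] ->
    even_odd A || odd_even A -> (1 <= #|A| + #|B|)%N ->
  [/\ supp ge2word (Dfrak_fuel fuel (cdrop A B)),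
      even_odd A -> supp ge2word1 (Dfrak_fuel fuel (cdrop A B))
    & forall N, (0 < N)%N -> zeta_lin N (Dfrak_fuel fuel (cdrop A B)) = block_tail N 0 (map predn (cdrop A B))].
  move=> A1 B1 eo AB; have cs := cdrop_succn A B1; have cn := cdrop_sumn A1 B1.
  have cz := cdrop_size A B; set b' := map predn (cdrop A B) in cs *.
  have s0 : (0 < size c)%N by rewrite size_map lt0n size_eq0.
  have oA : ~~ odd #|A|.
    by case/orP: eo => [|/odd_even_card //]; exact: (even_odd_card s0).
  have sb' : ~~ odd (size b') by rewrite size_map; move: sb oA; rewrite -cz oddD; do 2 case: odd.
  have [|P1 P2 P3] := IH b' sb'; first by rewrite cs -ltnS (leq_trans _ bf) // -/c -cn -addn1 leq_add2l.
  rewrite cs in P1 P2 P3; split=> // eA; apply: P2.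
  rewrite -size_eq0 size_map; apply: contraL (even_odd_lt s0 eA) => /eqP z0.
  by rewrite z0 add0n in cz; rewrite cz -leqNgt size_map.
have c0 : c != [::] by rewrite /c; case: (b) b0.
pose t N : rat := N%:R^-1.
pose f N s := block_tail N 0 (map predn s).
have DE := Dfrak_fuelE fuel c0.
have s1 : supp ge2word1 (Dfrak_fuel fuel.+1 c).
  rewrite DE; apply: suppD; first apply: suppD; apply: supp_sum => A _ /andP[A1 eA];
    apply: supp_sum => B _ /and3P[B1 AB _]; apply: suppZ;
    have [||P1 P2 _] := IHc A B A1 B1; rewrite ?eA ?orbT ?(ltnW AB) //.
  - by apply: supp_mulx; exact: P2.
  - by apply: supp_mulyx => //; rewrite -subn1 subn_gt0.
  - by apply: supp_mulyx => //; rewrite -subn1 subn_gt0.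
(* The first sum carries Z_(N+1) - Z_N and the other two Z_N; the extra sign in the even-odd sums
   reverses their contribution. *)
have dZ N : (0 < N)%N -> zeta_lin N.+1 (Dfrak_fuel fuel.+1 c) - zeta_lin N (Dfrak_fuel fuel.+1 c)
   = (double_sum (@eo_admissible c 1) (set_weight (t N) (f N)) - double_sum (@eo_admissible c 1) (set_weight (t N) (f N.+1)))
     - double_sum (@eo_admissible c 2) (set_weight (t N) (f N)) + double_sum (@oe_admissible c 2) (set_weight (t N) (f N)).
  move=> N0; have E m : (-1) ^+ m.+1 = - (-1) ^+ m :> rat by rewrite exprS mulN1r.
  rewrite DE zeta_lin_delta3; congr (_ + _ + _).
  - rewrite zeta_lin_delta_sum double_sumE double_sumB.
    apply: eq_double_sum => [A B|A B /andP[/andP[A1 eA] /and3P[B1 AB _]]]; first by rewrite /eo_admissible !andbA.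
    have [||_ /(_ eA) P2 P3] := IHc A B A1 B1; rewrite ?eA ?AB //.
    rewrite (zeta_lin_delta_x _ P2) ?P3 // /set_weight (E #|B|) /t exprVn /f; ring.
  - rewrite zeta_lin_delta_sum double_sumE double_sumN.
    apply: eq_double_sum => [A B|A B /andP[/andP[A1 eA] /and3P[B1 AB _]]]; first by rewrite /eo_admissible !andbA.
    have [||P1 P2 P3] := IHc A B A1 B1; rewrite ?eA ?(ltnW AB) //.
    move: AB; rewrite /set_weight; case: (#|A| + #|B|)%N => [//|n] n1.
    rewrite (zeta_lin_delta_yx P1) ?P3 // (E #|B|) /t exprVn /f; ring.
  rewrite zeta_lin_delta_sum double_sumE.
  apply: eq_double_sum => [A B|A B /andP[/andP[A1 eA] /and3P[B1 AB _]]]; first by rewrite /oe_admissible !andbA.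
  have [||P1 P2 P3] := IHc A B A1 B1; rewrite ?eA ?orbT ?(ltnW AB) //.
  move: AB; rewrite /set_weight; case: (#|A| + #|B|)%N => [//|n] n1.
  by rewrite (zeta_lin_delta_yx P1) ?P3 // /t exprVn.
split=> //; first exact: supp_ge2word.
have f0 N : f N (@cdrop c set0 set0) = block_tail N 0 b.
  rewrite /f; congr (block_tail N 0); rewrite cdrop_bits.
  have : size (bits (set0 : {set 'I_(size c)})) = size c by rewrite size_bits.
  have : all negb (bits (set0 : {set 'I_(size c)})).
    by apply/(all_nthP false) => i; rewrite size_bits => ic; rewrite (nth_bits set0 (Ordinal ic)) inE.
  move: (bits _) => s; rewrite /c size_map.
  elim: (b) s => [|x b' IHb] [|a s] //= /andP[/negbTE a0 sn] [ss].
  by rewrite a0 /= IHb.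
have fb N : f N \o map succn =1 block_tail N 0.
  by move=> s; rewrite /f /= -map_comp map_id_in // => x _.
case=> // N _; elim: N => [|N IHN].
  rewrite zeta_lin1_eq0 //; case: (b) sb b0 => [//|i [//|j d]] _ _; by rewrite block_tail0.
have := dZ N.+1 isT; rewrite IHN.
(* H3 merges the three sums over [f N.+1] into the odd-even sum of weight at least 1. H1 and H2
   complete it and the even-odd sum over [f N.+2] by the term with A and B empty, which is
   [block_tail] itself; H4 then cancels the completed sums. *)
have H1 := eo_sum_split0 (set_weight (t N.+1) (f N.+2) : {set 'I_(size c)} -> _).
have H2 := oe_sum_split0 (set_weight (t N.+1) (f N.+1) : {set 'I_(size c)} -> _).
have H3 := eo_oe_sum1 (set_weight (t N.+1) (f N.+1)) c0.
have H4 := reduce_block_tail (isT : 0 < N.+1)%N sb b0.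
rewrite double_sum_esum // esum_reduce_tail // in H1; rewrite double_sum_osum osum_reduce in H2.
rewrite (eq_reduce_tail _ _ (fb _)) in H1; rewrite (eq_reduce _ _ (fb _)) H4 in H2.
have w0 g : set_weight (t N.+1) g (set0 : {set 'I_(size c)}) set0 = g (@cdrop c set0 set0).
  by rewrite /set_weight !cards0 !expr0 !mul1r.
rewrite !w0 !f0 in H1 H2; move: H1 H2 H3; rewrite -/(t N.+1).
move: (zeta_lin _ _) (reduce_tail _ _ _) (block_tail _ _ _) (block_tail _ _ _) => z S b1 b2.
move: (double_sum _ _) (double_sum _ _) (double_sum _ _) (double_sum _ _) (double_sum _ _) => d1 d2 d3 d4 d5; lra.
Qed.

(** * Block form of words, and the kernel *)

Lemma mulr_central_assoc (A : pzRingType) (z p q : A) :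
  z * p = p * z -> z * (p * q) = p * (z * q).
Proof. by rewrite !mulrA => ->. Qed.

(* The library only makes {malg R[K]} a left algebra, even for commutative R. *)
Lemma H_scalerAr a (p q : H) : a *: (p * q) = p * (a *: q).
Proof.
have pC : a%:MP * p = p * a%:MP.
  rewrite [p]monalgE mulr_sumr mulr_suml.
  by apply: eq_bigr => m _; rewrite !malgM_def !fgmulUU mulrC mul1m mulm1.
rewrite -(mul_malgC a (p * q)) -(mul_malgC a q); exact: mulr_central_assoc.
Qed.

Fixpoint block_word (b : seq nat) : seq bool :=
  if b is i :: (j :: d) then nseq i.+1 true ++ nseq j.+1 false ++ block_word d else [::].

Definition admissible w := exists b, [/\ ~~ odd (size b), b != [::] & w = block_word b].

(** Induction on the length: a prefix y y lengthens the first run of y, a prefix y x y opens a new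
    block, and a prefix y x x lengthens the first run of x. *)
Lemma admissibleP v : admissible (true :: rcons v false).
Proof.
have [n] := ubnP (size v); elim: n v => // n IH [_|[] v /= vn].
- by exists [:: 0%N; 0%N].
- have [[|i [|j d]] [//= sb _ E]] := IH v vn; rewrite E.
  by exists [:: i.+1, j & d].
case: v vn => [_|[] v vn]; first by exists [:: 0%N; 1%N].
  have [b [sb b0 E]] := IH v (ltnW vn); rewrite rcons_cons E.
  by exists [:: 0%N, 0%N & b]; rewrite /= negbK.
have [[|i [|j d]] [//= sb _]] := IH (false :: v) vn.
case: i sb => [|i] //= sb [E]; exists [:: 0%N, j.+1 & d]; split=> //=.
by rewrite E.
Qed.

Lemma runs_cons a w : runs (a :: w) =
  if runs w is (b, n) :: s then
    if a == b then (b, n.+1) :: s else [:: (a, 1%N), (b, n) & s]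
  else [:: (a, 1%N)].
Proof. by []. Qed.

Lemma runs_nseq a n w : (if w is b :: _ then a != b else true) ->
  runs (nseq n.+1 a ++ w) = (a, n.+1) :: runs w.
Proof.
move=> aw; elim: n => [|n IH]; last first.
  by rewrite [nseq n.+2 a ++ w](_ : _ = a :: (nseq n.+1 a ++ w)) // runs_cons IH eqxx.
rewrite /=; case: w aw => [//|b w] ab /=.
by case: (runs w) => [|[b' m] s]; [|case: eqP => [<-|_]]; rewrite (negbTE ab).
Qed.

Lemma exps_block_word b : ~~ odd (size b) -> exps (block_word b) = map succn b.
Proof.
rewrite /exps; elim/list2_ind: b => [//|//|i j d IH] sb.
have sd : ~~ odd (size d) by rewrite /= negbK in sb.
rewrite [block_word _](_ : _ = nseq i.+1 true ++ (nseq j.+1 false ++ block_word d)) //.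
rewrite runs_nseq // runs_nseq; last by case: (d) => [|? [|? ?]].
by rewrite /= IH.
Qed.

Lemma block_word_index b : ~~ odd (size b) -> block_word b = index_word (block_index b).
Proof.
elim/list2_ind: b => [//|//|i j d IH]; rewrite /= negbK => /IH ->.
by elim: i => //= i ->.
Qed.

Lemma block_index_pos b : all (leq 1) (block_index b).
Proof.
elim/list2_ind: b => [//|//|i j d IH] /=; rewrite all_cat /= IH andbT.
by apply/allP => x /nseqP[->].
Qed.

Lemma zeta_block_word N b : ~~ odd (size b) -> zeta_word (block_word b) N = block_tail N 0 b.
Proof. by move=> sb; rewrite block_word_index // zeta_index_word ?block_index_pos. Qed.

Lemma yHx_supp q : in_yHx q -> supp admissible q.
Proof.
move=> [h ->]; rewrite yHE xHE [h]H_expand mulr_sumr mulr_suml.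
apply: supp_sum => m _ _; rewrite -H_scalerAr -scalerAl !wordU_cat cat1s cats1.
by apply: suppZ; apply: supp_wordU; rewrite rcons_cons; exact: admissibleP.
Qed.

Lemma D_word_block b : ~~ odd (size b) -> b != [::] ->
  supp ge2word1 (D_word (block_word b))
  /\ forall N, (0 < N)%N -> zeta_lin N (D_word (block_word b)) = zeta_word (block_word b) N.
Proof.
move=> sb b0; have -> : D_word (block_word b) = Dfrak (map succn b).
  by rewrite -exps_block_word //; case: b b0 sb => [|? [|? ?]].
have [_ P2 P3] := Dfrak_fuel_spec sb (leqnn _).
by split=> [|N N0]; [exact: P2 | rewrite zeta_block_word //; exact: P3].
Qed.

Lemma Dmap_supp q : supp admissible q -> supp ge2word1 (Dmap q).
Proof.
move=> qA; rewrite DmapE /linext; apply: supp_sum => m /qA[b [sb b0 ->]] _.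
by apply: suppZ; have [] := D_word_block sb b0.
Qed.

Lemma zeta_lin_Dmap N q : supp admissible q -> (0 < N)%N -> zeta_lin N (Dmap q) = zeta_lin N q.
Proof.
move=> qA N0; rewrite DmapE /linext /zeta_lin linext_sum -[RHS]/(zeta_lin N q) zeta_linE big_seq [RHS]big_seq.
apply: eq_bigr => m /qA[b [sb b0 ->]]; rewrite linextZ; congr (_ * _).
by have [_] := D_word_block sb b0; apply.
Qed.

Definition word_index (w : seq bool) : seq nat := if w is true :: s then idx_aux s else [::].

Lemma word_indexK k : all (leq 1) k -> word_index (index_word k) = k.
Proof. by case: k => [//|x k] /= /andP[x1 k1]; rewrite idx_aux_nseq // prednK. Qed.

(** Distinct words have distinct indices, so [harmonic_indep] applies with the largest depth that
    occurs. *)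
Lemma zeta_lin_inj r : supp ge2word r -> (forall N, (0 < N)%N -> zeta_lin N r = 0) -> r = 0.
Proof.
move=> rP r0; pose L := [seq rev (word_index (fmonom_val m)) | m <- msupp r].
pose c k := r@_(FMonom (index_word (rev k))).
have cE m : m \in msupp r -> c (rev (word_index (fmonom_val m))) = r@_m.
  move=> /rP[k k2 mk]; rewrite /c revK mk word_indexK ?all_ge21 // -mk.
  by congr (_@_ _); exact: fmK.
have uL : uniq L.
  rewrite map_inj_in_uniq ?fset_uniq // => m m' /rP[k k2 mk] /rP[k' k2' mk'].
  rewrite mk mk' !word_indexK ?all_ge21 // => /(can_inj revK) kk.
  by apply: val_inj; rewrite /= mk mk' kk.
have aL : all (fun k => (size k <= \max_(k <- L) size k)%N && all (leq 1) k) L.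
  apply/allP => k kL; rewrite leq_bigmax_seq //=.
  by case/mapP: kL => m /rP[k' k2 ->] ->; rewrite word_indexK ?all_rev ?all_ge21.
have H0 N : (0 < N)%N -> \sum_(k <- L) c k * harmonic k N = 0.
  move=> N0; rewrite -[RHS](r0 N N0) zeta_linE big_map big_seq [RHS]big_seq.
  apply: eq_bigr => m mr; rewrite cE //; have [k k2 ->] := rP m mr.
  by rewrite word_indexK ?all_ge21 // zeta_index_word ?all_ge21 // zeta_tail_harmonic.
apply/malgP => m; rewrite mcoeff0; case: (boolP (m \in msupp r)) => [mr|/mcoeff_outdom//].
rewrite -cE //; apply: (harmonic_indep uL aL H0); exact: (map_f (fun m => rev (word_index (fmonom_val m)))).
Qed.

Lemma malgC_scale c : c%:MP = c *: 1 :> H.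
Proof. by rewrite -mul_malgC mulr1. Qed.

Lemma lalg_affine_comb (K : pzRingType) (A : lalgType K) (y x h h' : A) (a c c' : K) :
  (forall u v : A, a *: (u * v) = u * (a *: v)) ->
  a *: (c *: 1 + y * h * x) + (c' *: 1 + y * h' * x)
  = (a * c + c') *: 1 + y * (a *: h + h') * x.
Proof.
move=> aA; rewrite mulrDr mulrDl -aA -scalerAl scalerDr scalerA scalerDl.
exact: addrACA.
Qed.

Lemma in_H0_lin a p q : in_H0 p -> in_H0 q -> in_H0 (a *: p + q).
Proof.
move=> [c [h ->]] [c' [h' ->]]; exists (a * c + c'), (a *: h + h').
rewrite !malgC_scale; apply: lalg_affine_comb => u v; exact: H_scalerAr.
Qed.

Lemma in_H00 : in_H0 0.
Proof. by exists 0, 0; rewrite malgC_scale scale0r mulr0 mul0r addr0. Qed.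

Lemma ge2word1_shape s : ge2word1 s -> exists v, s = true :: v ++ [:: false].
Proof.
move=> [k [+ +] ->]; case/lastP: k => [//|k x]; rewrite all_rcons => /andP[x2 _] _.
have -> : index_word (rcons k x) = (index_word k ++ true :: nseq x.-2 false) ++ [:: false].
  rewrite index_word_rcons -catA /=; congr (_ ++ _ :: _).
  by case: x x2 => [|[|n]] // _; rewrite -(nseqD n 1) addn1.
by case: k => [|y k] /=; eexists.
Qed.

Lemma supp_in_H0 p : supp ge2word1 p -> in_H0 p.
Proof.
move=> pP; rewrite [p]H_expand big_seq; elim/big_rec: _ => [|m q mp]; first exact: in_H00.
apply: in_H0_lin; have [v ->] := ge2word1_shape (pP m mp).
by exists 0, (wordU v); rewrite malgC_scale scale0r add0r yHE xHE !wordU_cat.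
Qed.

Theorem mainTheorem7 : forall p : H, in_KerZd p <-> in_Drop1 p.
Proof.
move=> p; split=> [[[c [h ->]] Z]|[s [sq ->]]].
  set q := yH * h * xH in Z *.
  have qy : in_yHx q by exists h.
  have qA := yHx_supp qy.
  have r0 : c%:MP + Dmap q = 0.
    apply: zeta_lin_inj => [|N N0].
      apply: suppD; last exact/supp_ge2word/Dmap_supp.
      by rewrite malgC_scale -wordU_nil; apply: suppZ; apply: supp_wordU; exists [::].
    by rewrite zeta_linD (zeta_lin_Dmap qA N0) -zeta_linD -ZdE Z.
  exists [:: (1, q)]; split=> [x|]; first by rewrite inE => /eqP ->.
  by rewrite big_seq1 scale1r (canRL (addrK _) r0) sub0r addrC.
split=> [|N N0].
  elim: s sq => [|x s IH] sq; first by rewrite big_nil; exact: in_H00.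
  rewrite big_cons; apply: in_H0_lin; last by apply: IH => y ys; apply: sq; rewrite inE ys orbT.
  have xy : in_yHx x.2 by apply: sq; rewrite inE eqxx.
  rewrite addrC -scaleN1r; apply: in_H0_lin; first exact/supp_in_H0/Dmap_supp/yHx_supp.
  by have [h ->] := xy; exists 0, h; rewrite malgC_scale scale0r add0r.
rewrite ZdE /zeta_lin linext_sum big_seq big1 // => x /sq xy; rewrite linextZ -/(zeta_lin _ _) zeta_linB.
by rewrite zeta_lin_Dmap ?subrr ?scaler0 //; exact: yHx_supp.
Qed.
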